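(* The maps $j:\mathcal H_{\mathrm{LOT}}^A\to\mathcal H_{\mathrm{BCK}}^A$, $\Omega_t:\mathcal H_{\mathrm{BCK}}^A\to\mathcal H_{\mathrm{MKW}}^A$, $\Omega_w:\mathcal H_{\mathrm{LOT}}^A\to\mathcal H_{\mathrm{PLOT}}^A$ and $J:\mathcal H_{\mathrm{PLOT}}^A\to\mathcal H_{\mathrm{MKW}}^A$ fit into a commutative square, that is, $$J\circ\Omega_w=\Omega_t\circ j.$$
   Context: $\mathbf{k}$ is a field of characteristic zero and $A$ is a finite set. Only the vector space and algebra structures below are needed to state the identity. Noncommutative words and $\mathcal H_{\mathrm{PLOT}}^A$. $\mathcal Z_A=\{z_i^a \mid a\in A,\ i\in\mathbb Z_{\ge -1}\}$, $\mathrm{wt}(z_i^a)=i$, $d(z_i^a)=a$. $V(A)\subseteq\mathbf{k}\langle\mathcal Z_A\rangle$ is the span of the monomials $z_{i_1}^{a_1}\cdots z_{i_p}^{a_p}$ with $\sum_{r=1}^p i_r=-1$ and $\sum_{r=1}^q i_r\ge 0$ for $1\le q<p$. $\mathcal W(A)=\{\mathbf w_1\cdots\mathbf w_m\mid m\ge0,\ \mathbf w_i\in V(A)\text{ monomials}\}$. As an algebra, $\mathcal H_{\mathrm{PLOT}}^A$ is $\mathbf{k}\mathcal W(A)$ with the shuffle product $\sqcup\!\sqcup$ of sequences $(\mathbf w_1,\dots,\mathbf w_m)$ (each monomial $\mathbf w_i\in V(A)$ is a single letter). (It is the graded dual of the enveloping algebra of the Lie algebra freely generated by the monomials of $V(A)$,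 expressed in the basis dual to $\mathcal W(A)$.) Planar trees and $\mathcal H_{\mathrm{MKW}}^A$. $\mathcal{OT}^A$ is the set of $A$-decorated planar rooted trees and $\mathcal{OF}^A$ the set of ordered forests (finite sequences of trees, including the empty one). As an algebra $\mathcal H_{\mathrm{MKW}}^A$ is $\mathbf{k}\,\mathcal{OF}^A$ with the shuffle product of forests viewed as words in trees. The root-subtree order on the vertices of a planar tree lists the root first, then the vertices of the subtrees attached to the root from left to right, each ordered recursively; if $v_1<\dots<v_p$ are the vertices of $t$, $d(v)$ is the decoration and $f(v)$ the number of children of $v$, put $\Phi_{\mathrm{fer}}^{\mathcal T}(t)=z_{f(v_1)-1}^{d(v_1)}\cdots z_{f(v_p)-1}^{d(v_p)}$; this is a bijection from $\mathcal{OT}^A$ onto the monomials of $V(A)$. $J$ is the linear isomorphism with $J(\mathbf w)=(\Phi_{\mathrm{fer}}^{\mathcal T})^{-1}(\mathbf w)$ for a monomial $\mathbf w\in V(A)$ and $J(\mathbf w_1\cdots\mathbf w_m)=J(\mathbf w_1)\cdots J(\mathbf w_m)$ (concatenation); it is an isomorphism of shuffle algebras. Commutative monomials and $\mathcal H_{\mathrm{LOT}}^A$. $\mathrm N(A)=\mathbf{k}[\bar x_j^a\mid a\in A,\ j\in\mathbb Z_{\ge-1}]$ is a commutative polynomial algebra, with weight $\mathrm{wt}(\bar x_j^a)=j$ additive on monomials, and $\mathrm N(A)_{-1}$ is its weight $-1$ component. $\mathcal M(A)$ is the set of commutative monomial forests $M_1^{\odot\ell_1}\odot\cdots\odot M_r^{\odot\ell_r}$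 ($r\ge0$, $M_i\in\mathrm N(A)_{-1}$ pairwise distinct monomials, $\ell_i\ge1$), including the empty one $\mathbf 1$; as an algebra $\mathcal H_{\mathrm{LOT}}^A$ is $\mathbf{k}\mathcal M(A)$ with commutative product $\odot$, i.e. the polynomial algebra on the weight $-1$ monomials. For $M=\prod(\bar x_j^a)^{k_j^a}\in \mathrm N(A)_{-1}$ put $\sigma(M)=\prod k_j^a!$, and $\sigma_{\mathrm w}(M_1^{\odot\ell_1}\odot\cdots\odot M_r^{\odot\ell_r})=\prod_i\ell_i!\,\sigma(M_i)^{\ell_i}$. Nonplanar trees and $\mathcal H_{\mathrm{BCK}}^A$. $\mathcal T(A)$, $\mathcal F(A)$ are the sets of $A$-decorated nonplanar rooted trees and forests; as an algebra $\mathcal H_{\mathrm{BCK}}^A$ is $\mathbf{k}\mathcal F(A)$ with disjoint union, the polynomial algebra on $\mathcal T(A)$. $\sigma_\tau(f)$ is the symmetry factor (order of the automorphism group) of the decorated rooted forest $f$. $F:\mathcal{OF}^A\to\mathcal F(A)$ forgets the planar structure and the order of trees. The maps. $\Omega_t(f)=\sigma_\tau(f)\sum_{\tilde f\in\mathcal{OF}^A,\ F(\tilde f)=f}\tilde f$ for $f\in\mathcal F(A)$. With $\Phi_{\mathrm{com}}^{\mathcal T}(\tau)=\prod_{v\in V(\tau)}\bar x_{f(v)-1}^{d(v)}$ for $\tau\in\mathcal T(A)$, $j$ is the algebra morphism with $j(M)=\sum_{\tau\in\mathcal T(A),\ \Phi_{\mathrm{com}}^{\mathcal T}(\tau)=M}\frac{\sigma_{\mathrm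 w}(M)}{\sigma_\tau(\tau)}\,\tau$ for monomials $M\in\mathrm N(A)_{-1}$. With the abelianization $\mathrm{Ab}(x_1\cdots x_p)=\prod_{m=1}^p\bar x_{\mathrm{wt}(x_m)}^{d(x_m)}$ for monomials $x_1\cdots x_p\in V(A)$, $\Omega_w$ is defined by $\Omega_w(\mathbf 1)=\mathbf 1$, $\Omega_w(M)=\sigma_{\mathrm w}(M)\sum_{\mathbf z\in V(A)\text{ monomial},\ \mathrm{Ab}(\mathbf z)=M}\mathbf z$ for monomials $M\in\mathrm N(A)_{-1}$, and $\Omega_w(\mathfrak M\odot\mathfrak N)=\Omega_w(\mathfrak M)\sqcup\!\sqcup\,\Omega_w(\mathfrak N)$. *)

(* Defs.v *)
(* MathComp, with finmap and multinomials' monalg for free modules and        *)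
(* polynomial algebras, and mathcomp-classical for finitely supported sums.   *)
From HB Require Import structures.
From mathcomp Require Import all_boot all_order all_algebra finmap.
From mathcomp Require Import fingroup perm zify generic_quotient.
From mathcomp Require Import boolp classical_sets cardinality fsbigop.
From mathcomp.multinomials Require Import monalg.

Set Implicit Arguments.
Unset Strict Implicit.
Unset Printing Implicit Defensive.
Import Order.TTheory GRing.Theory Num.Theory.
Local Open Scope ring_scope.

(* {malg k[K]} is the free module on K and {malg k[{cmonom I}]} the           *)
(* polynomial algebra on the variables I; lin_ext and poly_ext are the maps   *)
(* given by their universal properties, characterized by lin_extU and         *)
(* poly_extU.                                                                 *)

Section LinExt.
Context (k : fieldType) (K : choiceType) (V : lmodType k) (h : K -> V).

Definition lin_ext (x : {malg k[K]}) : V := \sum_(m <- msupp x) x@_m *: h m.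

Lemma lin_extEw (d : {fset K}) (x : {malg k[K]}) :
  (msupp x `<=` d)%fset -> lin_ext x = \sum_(m <- d) x@_m *: h m.
Proof.
move=> le_xd; apply: big_fset_incl => //= m _ /mcoeff_outdom ->.
by rewrite scale0r.
Qed.

Lemma lin_ext_is_linear : linear lin_ext.
Proof.
move=> c x y; pose d := (msupp x `|` msupp y)%fset.
have le_d : (msupp (c *: x + y) `<=` d)%fset.
  apply: fsubset_trans (msuppD_le _ _) _; apply: fsetSU.
  exact: msuppZ_le.
rewrite (lin_extEw le_d) (lin_extEw (fsubsetUl _ _ : (msupp x `<=` d)%fset)).
rewrite (lin_extEw (fsubsetUr _ _ : (msupp y `<=` d)%fset)).
rewrite scaler_sumr -big_split /=; apply: eq_bigr => m _.
by rewrite mcoeffD mcoeffZ scalerDl scalerA.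
Qed.

HB.instance Definition _ :=
  GRing.isLinear.Build k {malg k[K]} V *:%R lin_ext lin_ext_is_linear.

Lemma lin_extU m : lin_ext << m >> = h m.
Proof.
rewrite (lin_extEw (msuppU_le (k := m) (x := 1))) big_seq_fset1 mcoeffUU.
exact: scale1r.
Qed.

End LinExt.

Lemma lin_ext_unique (k : fieldType) (K : choiceType) (V : lmodType k)
    (f g : {linear {malg k[K]} -> V}) :
  (forall m, f << m >> = g << m >>) -> f =1 g.
Proof.
move=> eq_fg x; rewrite (monalgE x) !linear_sum; apply: eq_bigr => m _.
have -> : << x@_m *g m >> = x@_m *: << m >> :> {malg k[K]}.
  by apply/malgP => m'; rewrite mcoeffZ !mcoeffU mulrnAr mulr1.
by rewrite !linearZ_LR eq_fg.
Qed.

Lemma malgUZ (k : fieldType) (K : choiceType) (c : k) (m : K) :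
  << c *g m >> = c *: << m >> :> {malg k[K]}.
Proof. by apply/malgP => m'; rewrite mcoeffZ !mcoeffU mulrnAr mulr1. Qed.

Section PolyExt.
Context (k : fieldType) (I : choiceType) (S : comAlgType k) (g : I -> S).

Definition monom_ext (m : {cmonom I}) : S := \prod_(i <- finsupp m) g i ^+ m i.

Lemma monom_extEw (d : {fset I}) (m : {cmonom I}) :
  (finsupp m `<=` d)%fset -> monom_ext m = \prod_(i <- d) g i ^+ m i.
Proof.
move=> le_md; apply: big_fset_incl => //= i _.
by rewrite -cmE_eq0 => /eqP ->; rewrite expr0.
Qed.

Lemma monom_ext1 : monom_ext mone = 1.
Proof. by rewrite /monom_ext mdom1 big_seq_fset0. Qed.

Lemma monom_extM : {morph monom_ext : m n / mmul m n >-> m * n}.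
Proof.
move=> m n; rewrite /monom_ext mdomD.
rewrite -/(monom_ext m) -/(monom_ext n).
rewrite (monom_extEw (fsubsetUl (finsupp m) (finsupp n))).
rewrite (monom_extEw (fsubsetUr (finsupp m) (finsupp n))).
by rewrite -big_split /=; apply: eq_bigr => i _; rewrite cmM exprD.
Qed.

Lemma monom_extU i : monom_ext (ucm i) = g i.
Proof. by rewrite /monom_ext mdomU big_seq_fset1 cmUU expr1. Qed.

Definition poly_ext : {malg k[{cmonom I}]} -> S := lin_ext monom_ext.

HB.instance Definition _ := GRing.Linear.on poly_ext.

Lemma poly_ext_is_monoid_morphism : monoid_morphism poly_ext.
Proof.
split=> [|x y]; first by rewrite /poly_ext lin_extU monom_ext1.
have -> : x * y =
    \sum_(m <- msupp x) \sum_(n <- msupp y) (x@_m * y@_n) *: << mmul m n >>.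
  rewrite malgME; apply: eq_bigr => m _.
  by apply: eq_bigr => n _; rewrite malgUZ.
rewrite /poly_ext linear_sum [lin_ext _ x]/lin_ext mulr_suml.
apply: eq_bigr => m _; rewrite linear_sum [lin_ext _ y]/lin_ext mulr_sumr.
apply: eq_bigr => n _; rewrite linearZ_LR /= lin_extU monom_extM.
by rewrite -scalerAl -scalerAr scalerA.
Qed.

HB.instance Definition _ := GRing.isMonoidMorphism.Build
  {malg k[{cmonom I}]} S poly_ext poly_ext_is_monoid_morphism.

Lemma poly_extU i : poly_ext << ucm i >> = g i.
Proof. by rewrite /poly_ext lin_extU monom_extU. Qed.

End PolyExt.

(* The list of all shuffles of two words, with multiplicity *)
Fixpoint shuffle (T : Type) (s : seq T) : seq T -> seq (seq T) :=
  match s with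
  | [::] => fun t => [:: t]
  | a :: s' => fix shuffle_s (t : seq T) : seq (seq T) :=
      match t with
      | [::] => [:: s]
      | b :: t' => map (cons a) (shuffle s' t) ++ map (cons b) (shuffle_s t')
      end
  end.

(* An alias of {malg k[seq T]}, whose product is the shuffle product *)
Definition shuffle_alg (k : fieldType) (T : choiceType) : Type :=
  {malg k[seq T]}.

Lemma half_shuffle_assoc (V : zmodType) (mul : V -> V -> V) (pa pb pc : V -> V)
    (x y z : V) :
  (forall u v w, mul (u + v) w = mul u w + mul v w) ->
  (forall u v w, mul u (v + w) = mul u v + mul u w) ->
  (forall u v, pa (u + v) = pa u + pa v) ->
  (forall u v, pb (u + v) = pb u + pb v) ->
  (forall u v, pc (u + v) = pc u + pc v) ->
  (forall u v, mul (pa u) (pb v) = pa (mul u (pb v)) + pb (mul (pa u) v)) ->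
  (forall u v, mul (pa u) (pc v) = pa (mul u (pc v)) + pc (mul (pa u) v)) ->
  (forall u v, mul (pb u) (pc v) = pb (mul u (pc v)) + pc (mul (pb u) v)) ->
  mul x (mul (pb y) (pc z)) = mul (mul x (pb y)) (pc z) ->
  mul (pa x) (mul y (pc z)) = mul (mul (pa x) y) (pc z) ->
  mul (pa x) (mul (pb y) z) = mul (mul (pa x) (pb y)) z ->
  mul (pa x) (mul (pb y) (pc z)) = mul (mul (pa x) (pb y)) (pc z).
Proof.
move=> mulDl mulDr paD pbD pcD mul_ab mul_ac mul_bc IHa IHb IHc.
transitivity (pa (mul (mul x (pb y)) (pc z)) + pb (mul (mul (pa x) y) (pc z))
              + pc (mul (mul (pa x) (pb y)) z)).
  rewrite -IHa -IHb -IHc mul_bc mulDr mul_ab mul_ac addrACA -paD -mulDr -mul_bc.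
  by rewrite addrA.
by rewrite mul_ab !mulDl pcD mul_ac mul_bc [RHS]addrACA.
Qed.

Section ShuffleAlgebra.
Context (k : fieldType) (T : choiceType).
Notation Sh := (shuffle_alg k T).
Implicit Types (s t u : seq T) (x y z : Sh).

HB.instance Definition _ := GRing.Lmodule.on Sh.

Definition shuffle_words s t : Sh := \sum_(u <- shuffle s t) << u >>.

Definition shuffle_mul x y : Sh :=
  lin_ext (fun s => lin_ext (fun t => shuffle_words s t) y) x.

Local Notation "x ** y" := (shuffle_mul x y) (at level 40).

Lemma shuffle_mulUU s t : (<< s >> : Sh) ** << t >> = shuffle_words s t.
Proof. by rewrite /shuffle_mul !lin_extU. Qed.

Lemma shuffle_mulDZl c x y z : (c *: x + y) ** z = c *: (x ** z) + y ** z.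
Proof. exact: linearP. Qed.

Lemma shuffle_mulDZr c x y z : x ** (c *: y + z) = c *: (x ** y) + x ** z.
Proof.
rewrite /shuffle_mul /lin_ext scaler_sumr -big_split /=.
apply: eq_bigr => s _; rewrite -!/(lin_ext _ _) linearP scalerDr !scalerA.
by rewrite mulrC.
Qed.

Definition shuffle_mull z : Sh -> Sh := fun x => x ** z.
Definition shuffle_mulr z : Sh -> Sh := fun x => z ** x.

HB.instance Definition _ z := GRing.isLinear.Build k Sh Sh *:%R (shuffle_mull z)
  (fun c x y => shuffle_mulDZl c x y z).
HB.instance Definition _ z := GRing.isLinear.Build k Sh Sh *:%R (shuffle_mulr z)
  (fun c x y => shuffle_mulDZr c z x y).

Lemma shuffle0s t : shuffle_words [::] t = << t >>.
Proof. by rewrite /shuffle_words /= big_seq1. Qed.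

Lemma shuffles0 s : shuffle_words s [::] = << s >>.
Proof. by case: s => [|a s]; rewrite /shuffle_words /= big_seq1. Qed.

Definition prefix_letter (a : T) : Sh -> Sh := lin_ext (fun s => << a :: s >>).

HB.instance Definition _ a := GRing.Linear.on (prefix_letter a).

Lemma prefix_letter_shuffle a s t :
  prefix_letter a (shuffle_words s t) =
  \sum_(u <- map (cons a) (shuffle s t)) << u >>.
Proof.
rewrite linear_sum /= big_map; apply: eq_bigr => u _.
by rewrite /prefix_letter lin_extU.
Qed.

Lemma shuffle_cons a b s t :
  shuffle_words (a :: s) (b :: t) =
  prefix_letter a (shuffle_words s (b :: t))
  + prefix_letter b (shuffle_words (a :: s) t).
Proof. by rewrite !prefix_letter_shuffle -big_cat. Qed.

Lemma shuffle_wordsC s t : shuffle_words s t = shuffle_words t s.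
Proof.
have [n] := ubnP (size s + size t)%N.
elim: n => // n IHn in s t *; case: s t => [|a s] [|b t] lt_n.
- by rewrite shuffle0s.
- by rewrite shuffle0s shuffles0.
- by rewrite shuffle0s shuffles0.
rewrite !shuffle_cons addrC; congr (prefix_letter _ _ + prefix_letter _ _).
  by apply: IHn; move: lt_n; rewrite /= addnS.
by apply: IHn; move: lt_n; rewrite /= addSn.
Qed.

Lemma prefix_letterU a s : prefix_letter a << s >> = << a :: s >>.
Proof. exact: lin_extU. Qed.

Lemma shuffle_prefix a b x y :
  prefix_letter a x ** prefix_letter b y =
  prefix_letter a (x ** prefix_letter b y)
  + prefix_letter b (prefix_letter a x ** y).
Proof.
pose F1 z : Sh -> Sh := shuffle_mull (prefix_letter b z) \o prefix_letter a.
pose F2 z : Sh -> Sh :=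
  (prefix_letter a \o shuffle_mull (prefix_letter b z))
  \+ (prefix_letter b \o shuffle_mull z \o prefix_letter a).
have -> : prefix_letter a x ** prefix_letter b y = F1 y x by [].
rewrite [RHS](_ : _ = F2 y x) //.
apply: (lin_ext_unique (f := F1 y) (g := F2 y)) => s.
pose G1 : Sh -> Sh := shuffle_mulr (prefix_letter a << s >>) \o prefix_letter b.
pose G2 : Sh -> Sh :=
  (prefix_letter a \o shuffle_mulr << s >> \o prefix_letter b)
  \+ (prefix_letter b \o shuffle_mulr (prefix_letter a << s >>)).
rewrite [LHS](_ : _ = G1 y) // [RHS](_ : _ = G2 y) //.
apply: (lin_ext_unique (f := G1) (g := G2)) => t.
rewrite /G1 /G2 /= /shuffle_mulr !prefix_letterU !shuffle_mulUU.
exact: shuffle_cons.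
Qed.

Lemma shuffle_mul1x : left_id (<< [::] >> : Sh) shuffle_mul.
Proof.
move=> x; rewrite -[LHS]/(shuffle_mulr << [::] >> x) -[RHS]/(idfun x).
apply: lin_ext_unique => t /=.
by rewrite /shuffle_mulr shuffle_mulUU shuffle0s.
Qed.

Lemma shuffle_mulC : commutative shuffle_mul.
Proof.
move=> x y; rewrite -[LHS]/(shuffle_mull y x) -[RHS]/(shuffle_mulr y x).
apply: lin_ext_unique => s /=.
rewrite -[LHS]/(shuffle_mulr << s >> y) -[RHS]/(shuffle_mull << s >> y).
apply: lin_ext_unique => t /=.
by rewrite /shuffle_mulr /shuffle_mull !shuffle_mulUU shuffle_wordsC.
Qed.

Lemma shuffle_mulx1 : right_id (<< [::] >> : Sh) shuffle_mul.
Proof. by move=> x; rewrite shuffle_mulC shuffle_mul1x. Qed.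

Lemma shuffle_mulDl x y z : (x + y) ** z = x ** z + y ** z.
Proof. exact: (raddfD (shuffle_mull z)). Qed.

Lemma shuffle_mulDr x y z : x ** (y + z) = x ** y + x ** z.
Proof. exact: (raddfD (shuffle_mulr x)). Qed.

Lemma prefix_letterD a x y :
  prefix_letter a (x + y) = prefix_letter a x + prefix_letter a y.
Proof. exact: linearD. Qed.

Lemma shuffle_wordsA s t u :
  (<< s >> : Sh) ** (<< t >> ** << u >>) = << s >> ** << t >> ** << u >>.
Proof.
have [n] := ubnP (size s + size t + size u)%N.
elim: n => [|n IHn] in s t u * => lt_n.
  by exfalso; rewrite ltn0 in lt_n.
case: s lt_n => [|a s] lt_n; first by rewrite !shuffle_mul1x.
case: t lt_n => [|b t] lt_n; first by rewrite shuffle_mul1x shuffle_mulx1.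
case: u lt_n => [|c u] lt_n; first by rewrite !shuffle_mulx1.
rewrite -!prefix_letterU.
set x := (<< s >> : Sh); set y := (<< t >> : Sh); set z := (<< u >> : Sh).
have IH1 : x ** (prefix_letter b y ** prefix_letter c z) =
           x ** prefix_letter b y ** prefix_letter c z.
  rewrite !prefix_letterU; apply: IHn => /=.
  by move: lt_n; rewrite /= !(addSn, addnS, ltnS).
have IH2 : prefix_letter a x ** (y ** prefix_letter c z) =
           prefix_letter a x ** y ** prefix_letter c z.
  rewrite !prefix_letterU; apply: IHn => /=.
  by move: lt_n; rewrite /= !(addSn, addnS, ltnS).
have IH3 : prefix_letter a x ** (prefix_letter b y ** z) =
           prefix_letter a x ** prefix_letter b y ** z.
  rewrite !prefix_letterU; apply: IHn => /=.
  by move: lt_n; rewrite /= !(addSn, addnS, ltnS).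
apply: (@half_shuffle_assoc Sh shuffle_mul (@prefix_letter a)
  (@prefix_letter b) (@prefix_letter c)) IH1 IH2 IH3.
- exact: shuffle_mulDl.
- exact: shuffle_mulDr.
- exact: prefix_letterD.
- exact: prefix_letterD.
- exact: prefix_letterD.
- exact: shuffle_prefix.
- exact: shuffle_prefix.
- exact: shuffle_prefix.
Qed.

Lemma shuffle_mulA : associative (shuffle_mul).
Proof.
move=> x y z.
rewrite -[LHS]/(shuffle_mull (y ** z) x).
rewrite -[RHS]/((shuffle_mull z \o shuffle_mull y) x).
apply: lin_ext_unique => s /=.
rewrite -[LHS]/((shuffle_mulr << s >> \o shuffle_mull z) y).
rewrite -[RHS]/((shuffle_mull z \o shuffle_mulr << s >>) y).
apply: lin_ext_unique => t /=.
rewrite -[LHS]/((shuffle_mulr << s >> \o shuffle_mulr << t >>) z).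
rewrite -[RHS]/(shuffle_mulr ((<< s >> : Sh) ** << t >>) z).
by apply: lin_ext_unique => u /=; apply: shuffle_wordsA.
Qed.

Lemma shuffle_one_neq0 : (<< [::] >> : Sh) != 0.
Proof. by rewrite monalgU_eq0 oner_neq0. Qed.

HB.instance Definition _ := GRing.Zmodule_isComNzRing.Build Sh
  shuffle_mulA shuffle_mulC shuffle_mul1x shuffle_mulDl shuffle_one_neq0.

Lemma shuffle_scaleAl (c : k) (x y : Sh) : c *: (x * y) = c *: x * y.
Proof. by rewrite -[RHS]/(shuffle_mull y (c *: x)) linearZ_LR. Qed.

HB.instance Definition _ :=
  GRing.Lmodule_isLalgebra.Build k Sh shuffle_scaleAl.
HB.instance Definition _ := GRing.Lalgebra_isComAlgebra.Build k Sh.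

End ShuffleAlgebra.

(* The pair (a, i) stands both for the noncommutative letter z_i^a and for    *)
(* the commuting variable xbar_i^a.                                           *)
Definition zindex : Type := {i : int | -1 <= i}.
HB.instance Definition _ := Choice.on zindex.

Lemma index_of_nat_subproof (n : nat) : -1 <= n%:Z - 1.
Proof. by rewrite lerBrDr addNr. Qed.

Definition pred_index (n : nat) : zindex :=
  exist _ (n%:Z - 1) (index_of_nat_subproof n).

Definition letter (A : finType) : Type := (A * zindex)%type.
HB.instance Definition _ (A : finType) := Choice.on (letter A).

Definition wt (A : finType) (z : letter A) : int := val z.2.

Definition weight (A : finType) (w : seq (letter A)) : int := \sum_(z <- w) wt z.

(* The bounded quantifier ranges over the proper nonempty prefixes of w. *)
Definition in_V (A : finType) (w : seq (letter A)) : bool :=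
  (weight w == -1) &&
  [forall q : 'I_(size w), (0 < q)%N ==> (0 <= weight (take q w))].

Definition Vword (A : finType) : Type := {w : seq (letter A) | in_V w}.
HB.instance Definition _ (A : finType) := Choice.on (Vword A).

Inductive ptree (A : Type) : Type := Node of A & seq (ptree A).

Definition deco (A : Type) (t : ptree A) : A := let: Node a _ := t in a.
Definition children (A : Type) (t : ptree A) : seq (ptree A) :=
  let: Node _ ts := t in ts.

Lemma ptree_forest_ind (A : Type) (P : ptree A -> Prop)
    (Q : seq (ptree A) -> Prop) :
  (forall a ts, Q ts -> P (Node a ts)) ->
  Q [::] -> (forall t ts, P t -> Q ts -> Q (t :: ts)) ->
  (forall t, P t) /\ (forall ts, Q ts).
Proof.
move=> PN Q0 Qc.
pose fix F (t : ptree A) : P t :=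
  let: Node a ts := t in
  PN a ts ((fix G (us : seq (ptree A)) : Q us :=
    match us with [::] => Q0 | u :: us' => Qc u us' (F u) (G us') end) ts).
by split=> //; elim=> // t ts IH; exact: (Qc _ _ (F t) IH).
Qed.

Section PtreeChoice.
Variable A : countType.

Fixpoint ptree_encode (t : ptree A) : GenTree.tree A :=
  let: Node a ts := t in GenTree.Node 0 (GenTree.Leaf a :: map ptree_encode ts).

Fixpoint ptree_decode (g : GenTree.tree A) : option (ptree A) :=
  if g is GenTree.Node _ (GenTree.Leaf a :: gs)
  then Some (Node a (pmap ptree_decode gs)) else None.

Lemma ptree_encodeK : pcancel ptree_encode ptree_decode.
Proof.
suff: (forall t, ptree_decode (ptree_encode t) = Some t) /\
      (forall ts, pmap ptree_decode (map ptree_encode ts) = ts) by case.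
apply: ptree_forest_ind => //= [a ts -> //|t ts -> /= -> //].
Qed.

HB.instance Definition _ := Countable.copy (ptree A) (pcan_type ptree_encodeK).

End PtreeChoice.

(* A vertex of an ordered forest is recorded as its address (the position of  *)
(* its tree in the forest, then the child positions leading to it) together   *)
(* with the subtree hanging from it.  Vertices are listed in the root-subtree *)
(* order.                                                                     *)

Section Vertices.
Variable A : finType.
Notation vtx := (seq nat * ptree A)%type.
Implicit Types (t u : ptree A) (f g : seq (ptree A)).

Definition graft_vertices (ss : seq (seq vtx)) : seq vtx :=
  [seq (i :: v.1, v.2) | i <- iota 0 (size ss), v <- nth [::] ss i].

Fixpoint tree_vertices t : seq vtx :=
  let: Node a ts := t in ([::], t) :: graft_vertices (map tree_vertices ts).

Definition forest_vertices f : seq vtx :=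
  graft_vertices (map tree_vertices f).

Definition vertex_letter (v : vtx) : letter A :=
  (deco v.2, pred_index (size (children v.2))).

Definition fer_word t : seq (letter A) := map vertex_letter (tree_vertices t).

Definition fer_words f : seq (letter A) := flatten (map fer_word f).

Lemma map_graft_vertices (B : Type) (h : ptree A -> B) (ss : seq (seq vtx)) :
  [seq h v.2 | v <- graft_vertices ss] = flatten [seq [seq h v.2 | v <- s] | s <- ss].
Proof.
rewrite /graft_vertices map_flatten; congr flatten.
rewrite -map_comp; apply: (@eq_from_nth _ [::]); rewrite !size_map ?size_iota //.
move=> i lt_i; rewrite !(nth_map 0%N) ?size_iota //.
by rewrite nth_iota //= (nth_map [::]) // -map_comp.
Qed.

Lemma fer_wordE a f :
  fer_word (Node a f) = (a, pred_index (size f)) :: fer_words f.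
Proof.
rewrite /fer_word /= -/(forest_vertices _) /fer_words; congr (_ :: _).
rewrite (map_graft_vertices (fun t => (deco t, pred_index (size (children t))))).
by rewrite -map_comp.
Qed.

Lemma fer_words_vertices f : map vertex_letter (forest_vertices f) = fer_words f.
Proof.
rewrite (map_graft_vertices (fun t => (deco t, pred_index (size (children t))))).
by rewrite -map_comp.
Qed.

Lemma fer_words_cons t f : fer_words (t :: f) = fer_word t ++ fer_words f.
Proof. by []. Qed.

Lemma fer_words_cat f g : fer_words (f ++ g) = fer_words f ++ fer_words g.
Proof. by rewrite /fer_words map_cat flatten_cat. Qed.

Lemma weight_cat (v w : seq (letter A)) : weight (v ++ w) = weight v + weight w.
Proof. exact: big_cat. Qed.

Lemma weight_cons z (w : seq (letter A)) : weight (z :: w) = wt z + weight w.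
Proof. exact: big_cons. Qed.

Lemma weight_nil : weight ([::] : seq (letter A)) = 0.
Proof. exact: big_nil. Qed.

Lemma weight_fer :
  (forall t, weight (fer_word t) = -1 /\
     forall q, (q < size (fer_word t))%N -> -1 < weight (take q (fer_word t))) /\
  (forall f, weight (fer_words f) = - (size f)%:Z /\
     forall q, (q < size (fer_words f))%N ->
               - (size f)%:Z < weight (take q (fer_words f))).
Proof.
apply: ptree_forest_ind => [a ts [IH1 IH2]||t ts [IHt1 IHt2] [IH1 IH2]].
- rewrite fer_wordE; split=> [|[|q]] /=.
  + by rewrite weight_cons IH1 /wt /=; lia.
  + by rewrite weight_nil.
  + by rewrite ltnS => /IH2; rewrite weight_cons /wt /=; lia.
- by rewrite /fer_words /=; split; rewrite ?weight_nil.
rewrite /fer_words /= -/(fer_words ts); split=> [|q].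
  by rewrite weight_cat IHt1 IH1; lia.
rewrite take_cat size_cat; case: (ltnP q (size (fer_word t))) => [lt_q _|le_q lt_q].
  by move: (IHt2 _ lt_q) => /=; lia.
rewrite weight_cat IHt1.
have /IH2 : (q - size (fer_word t) < size (fer_words ts))%N by lia.
by lia.
Qed.

Lemma fer_word_in_V t : in_V (fer_word t).
Proof.
have [[wt_t pre_t] _] := (weight_fer.1 t, tt).
rewrite /in_V wt_t eqxx; apply/forallP => q; apply/implyP => _.
by move: (pre_t q (ltn_ord q)); lia.
Qed.

Definition Phi_fer t : Vword A := exist _ (fer_word t) (fer_word_in_V t).

Fixpoint parse (w : seq (letter A)) : seq (ptree A) :=
  if w is z :: w' then
    let n := absz (wt z + 1) in
    Node z.1 (take n (parse w')) :: drop n (parse w')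
  else [::].

Lemma parse_fer :
  (forall t w, parse (fer_word t ++ w) = t :: parse w) /\
  (forall f w, parse (fer_words f ++ w) = f ++ parse w).
Proof.
apply: ptree_forest_ind => [a ts IH w||t ts IHt IHts w] //.
  rewrite fer_wordE /= IH /wt /= subrK absz_nat.
  by rewrite take_size_cat // drop_size_cat.
by rewrite /fer_words /= -catA IHt IHts.
Qed.

Lemma parse_fer_words f : parse (fer_words f) = f.
Proof. by rewrite -[fer_words f]cats0 parse_fer.2 cats0. Qed.

Lemma fer_words_inj : injective fer_words.
Proof. exact: can_inj parse_fer_words. Qed.

Lemma Phi_fer_inj : injective Phi_fer.
Proof.
move=> t u /(congr1 val) /= eq_tu.
have : fer_words [:: t] = fer_words [:: u] by rewrite /fer_words /= eq_tu.
by case/fer_words_inj.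
Qed.

Lemma fer_words_surj (n : nat) (w : seq (letter A)) :
  weight w = - n%:Z ->
  (forall q, (q < size w)%N -> - n%:Z < weight (take q w)) ->
  exists f, size f = n /\ fer_words f = w.
Proof.
elim: w n => [|[a i] w IHw] n.
  by rewrite weight_nil => n0 _; exists [::]; split=> //=; lia.
rewrite weight_cons => wt_w /[dup] pre_w0 pre_w.
pose x : int := wt (a, i).
have le_x : -1 <= x := valP i.
rewrite -/x in wt_w.
have {}pre_w q : (q < size w)%N -> - n%:Z < x + weight (take q w).
  by move=> lt_q; move: (pre_w q.+1 lt_q); rewrite /= weight_cons.
have n_gt0 : (0 < n)%N.
  by move: (pre_w0 0%N isT); rewrite take0 weight_nil; lia.
have nx_ge0 : 0 <= n%:Z + x by lia.
have [||f [sz_f def_w]] := IHw (absz (n%:Z + x)).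
- by lia.
- by move=> q /pre_w; lia.
pose m := absz (x + 1).
have le_m : (m <= size f)%N by rewrite sz_f /m; lia.
exists (Node a (take m f) :: drop m f); split.
  by rewrite /= size_drop sz_f /m; lia.
rewrite -def_w fer_words_cons fer_wordE cat_cons -fer_words_cat cat_take_drop.
congr ((_, _) :: _); apply: val_inj; rewrite -[RHS]/x /=.
by rewrite size_takel // /m; lia.
Qed.

Lemma Phi_fer_surj (w : Vword A) : exists t, Phi_fer t == w.
Proof.
case: w => w Vw; have /andP[/eqP wt_w /forallP pre_w] := Vw.
have [|q lt_q|[|t [|? ?]] [//= _ def_w]] := @fer_words_surj 1 w.
- by rewrite wt_w.
- case: q => [|q] in lt_q *; first by rewrite take0 weight_nil.
  by move: (pre_w (Ordinal lt_q)) => /=; lia.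
exists t; rewrite -val_eqE /=.
by rewrite -def_w /fer_words /= cats0.
Qed.

Definition Phi_fer_inv (w : Vword A) : ptree A := xchoose (Phi_fer_surj w).

Lemma Phi_fer_invK : cancel Phi_fer_inv Phi_fer.
Proof. by move=> w; apply/eqP/(xchooseP (Phi_fer_surj w)). Qed.

Lemma Phi_ferK : cancel Phi_fer Phi_fer_inv.
Proof. by move=> t; apply: Phi_fer_inj; rewrite Phi_fer_invK. Qed.

Lemma Phi_fer_bij : bijective Phi_fer.
Proof. by exists Phi_fer_inv; [apply: Phi_ferK|apply: Phi_fer_invK]. Qed.

(* Words have at most one factorization into monomials of V(A), so the set    *)
(* W(A) of their concatenations is identified with seq (Vword A).             *)
Lemma concat_Vwords_inj :
  injective (fun ws : seq (Vword A) => flatten (map val ws)).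
Proof.
have val_fer (ws : seq (Vword A)) :
    flatten (map val ws) = fer_words (map Phi_fer_inv ws).
  rewrite /fer_words -map_comp; congr flatten; apply: eq_map => w /=.
  by rewrite -[in LHS](Phi_fer_invK w).
move=> ws ws'; rewrite !val_fer => /fer_words_inj.
exact/inj_map/(can_inj Phi_fer_invK).
Qed.

End Vertices.

Section Isomorphisms.
Variable A : finType.
Implicit Types f g h : seq (ptree A).

Definition vertex f : finType := seq_sub (forest_vertices f).

Definition vdeco f (v : vertex f) : A := deco (val v).2.
Definition vfert f (v : vertex f) : nat := size (children (val v).2).

(* edge u v: u is the parent of v *)
Definition edge f (u v : vertex f) : bool :=
  (size (val v).1 == (size (val u).1).+1) && prefix (val u).1 (val v).1.

Definition respects f g (phi : vertex f -> vertex g) : bool :=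
  [forall v, vdeco (phi v) == vdeco v] &&
  [forall u, [forall v, edge (phi u) (phi v) == edge u v]].

Lemma respectsP f g (phi : vertex f -> vertex g) :
  reflect ((forall v, vdeco (phi v) = vdeco v) /\
           (forall u v, edge (phi u) (phi v) = edge u v)) (respects phi).
Proof.
apply: (iffP andP) => -[H1 H2]; split.
- by move=> v; apply/eqP/(forallP H1).
- by move=> u v; apply/eqP/(forallP (forallP H2 u)).
- by apply/forallP => v; rewrite H1.
- by apply/forallP => u; apply/forallP => v; rewrite H2.
Qed.

(* As the roots are the vertices without a parent, such a bijection also      *)
(* matches the roots.                                                         *)
Definition forest_iso f g : bool :=
  `[< exists2 phi : vertex f -> vertex g, bijective phi & respects phi >].

Lemma forest_iso_refl f : forest_iso f f.
Proof. by apply/asboolP; exists id; [exists id|apply/respectsP]. Qed.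

Lemma forest_iso_sym f g : forest_iso f g -> forest_iso g f.
Proof.
case/asboolP => phi [psi phiK psiK] /respectsP[phi_dec phi_edge].
apply/asboolP; exists psi; first by exists phi.
by apply/respectsP; split=> [v|u v]; rewrite -?phi_dec -?phi_edge !psiK.
Qed.

Lemma forest_iso_trans g f h : forest_iso f g -> forest_iso g h -> forest_iso f h.
Proof.
case/asboolP => phi bij_phi /respectsP[phi_dec phi_edge].
case/asboolP => psi bij_psi /respectsP[psi_dec psi_edge].
apply/asboolP; exists (psi \o phi); first exact: bij_comp.
apply/respectsP; split=> [v|u v] /=; first by rewrite psi_dec phi_dec.
by rewrite psi_edge phi_edge.
Qed.

Definition forest_aut f : {set {perm vertex f}} :=
  finset (fun s : {perm vertex f} => respects s).

Lemma forest_aut_group_set f : group_set (forest_aut f).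
Proof.
apply/group_setP; split=> [|s s']; rewrite !inE.
  by apply/respectsP; split=> [v|u v]; rewrite !perm1.
move=> /respectsP[s_dec s_edge] /respectsP[s'_dec s'_edge].
by apply/respectsP; split=> [v|u v]; rewrite !permM ?s'_dec ?s'_edge.
Qed.

Canonical forest_aut_group f := Group (forest_aut_group_set f).

Lemma card_forest_aut_gt0 f : (0 < #|forest_aut f|)%N.
Proof. exact: (cardG_gt0 (forest_aut_group f)). Qed.

Definition tree_iso (t u : ptree A) : bool := forest_iso [:: t] [:: u].

Lemma tree_iso_equiv : equiv_class_of tree_iso.
Proof.
split=> [t|t u|u t v]; first exact: forest_iso_refl.
- by apply/idP/idP; apply: forest_iso_sym.
- exact: forest_iso_trans.
Qed.

Canonical tree_iso_equiv_rel := EquivRelPack tree_iso_equiv.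

End Isomorphisms.

(* Nonplanar trees are planar trees up to isomorphism, and nonplanar forests  *)
(* are multisets {cmonom (ntree A)} of nonplanar trees.                       *)
Definition ntree (A : finType) : Type := {eq_quot (@tree_iso A)}%qT.
HB.instance Definition _ (A : finType) := Choice.on (ntree A).
HB.instance Definition _ (A : finType) := EqQuotient.on (ntree A).
Definition nclass (A : finType) (t : ptree A) : ntree A := \pi_(ntree A)%qT t.

Section Quotient.
Variable A : finType.
Implicit Types (t u : ptree A) (f g : seq (ptree A)) (p : seq nat).

Lemma nclassP t u : nclass t = nclass u <-> tree_iso t u.
Proof. by split=> [/eqmodP|iso_tu] //; apply/eqmodP. Qed.

Lemma nclass_repr (tau : ntree A) : nclass (generic_quotient.repr tau) = tau.
Proof. exact: reprK. Qed.

Definition subtree_at f p : option (ptree A) :=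
  if p is i :: p' then
    foldl (fun o j => obind (fun t => onth (children t) j) o) (onth f i) p'
  else None.

Lemma mem_graft (ss : seq (seq (seq nat * ptree A))) i p t :
  ((i :: p, t) \in graft_vertices ss) = ((p, t) \in nth [::] ss i).
Proof.
apply/allpairsPdep/idP => [[j [[q u]] [_ qu [-> -> ->]]] //|pt].
exists i, (p, t); split=> //; rewrite mem_iota add0n /=.
by case: ltnP => // le_i; rewrite nth_default in pt.
Qed.

Lemma mem_forest_vertices f p t :
  ((p, t) \in forest_vertices f) = (subtree_at f p == Some t).
Proof.
elim: p f => [|i p IHp] f.
  by apply/allpairsPdep => -[j [v [_ _ []]]].
rewrite mem_graft /=; case def_u: (onth f i) => [u|] /=; last first.
  rewrite nth_default; first by elim: p {IHp}.
  by rewrite size_map -onthNE def_u.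
have lt_i : (i < size f)%N by rewrite -onthTE def_u.
rewrite (nth_map u) // (onth_nth _ _ _ _ def_u); case: u {def_u} => a us /=.
rewrite in_cons xpair_eqE -/(forest_vertices us) IHp.
case: p {IHp} => [|j p] //=.
by rewrite orbF eq_sym.
Qed.

Lemma subtree_at_rcons f p i t :
  subtree_at f p = Some t ->
  subtree_at f (rcons p i) = onth (children t) i.
Proof. by case: p => [|j p] //= ft; rewrite foldl_rcons ft. Qed.

Lemma vertex_subtree f (v : vertex f) : subtree_at f (val v).1 = Some (val v).2.
Proof. by apply/eqP; rewrite -mem_forest_vertices -surjective_pairing; apply: valP. Qed.

Lemma vfertE f (v : vertex f) : vfert v = #|[pred w | edge v w]|.
Proof.
have sub_v := vertex_subtree v.
pose t := (val v).2; rewrite -/t in sub_v.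
have child_in (i : 'I_(size (children t))) :
    (rcons (val v).1 i, nth t (children t) i) \in forest_vertices f.
  rewrite mem_forest_vertices (subtree_at_rcons _ sub_v).
  case def_u: (onth _ _) => [u|]; first by rewrite (onth_nth _ _ _ _ def_u).
  by move: (ltn_ord i); rewrite -onthTE def_u.
pose h i : vertex f := SeqSub (child_in i).
have inj_h : injective h.
  move=> i j /(congr1 (fun w => (val w).1)) /= /rcons_inj[] eq_ij.
  exact: val_inj.
rewrite -[LHS]card_ord -(card_codom inj_h); apply: eq_card => w.
rewrite !inE /edge; apply/codomP/andP => [[i ->] /=|[/eqP sz_w /prefixP[r def_w]]].
  by rewrite size_rcons prefix_rcons.
case: r => [|i [|? ?]] in def_w *; first by move: sz_w; rewrite def_w cats0; lia.
  move: def_w; rewrite cats1 => def_w.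
  have := vertex_subtree w; rewrite def_w (subtree_at_rcons _ sub_v) => def_u.
  have lt_i : (i < size (children t))%N by rewrite -onthTE def_u.
  exists (Ordinal lt_i); apply: val_inj => /=.
  by rewrite (onth_nth _ _ _ _ def_u) -def_w -surjective_pairing.
by move: sz_w; rewrite def_w size_cat /=; lia.
Qed.

Lemma uniq_vertices :
  (forall t, uniq (tree_vertices t)) /\ (forall f, uniq (forest_vertices f)).
Proof.
have uniq_graft f : (forall t, t \in f -> uniq (tree_vertices t)) ->
    uniq (forest_vertices f).
  move=> uniq_f; apply: allpairs_uniq_dep; first exact: iota_uniq.
    move=> i; rewrite mem_iota size_map /= => lt_i.
    case: f => [|t f] in uniq_f lt_i *; first by [].
    by rewrite (nth_map t) //; apply/uniq_f/mem_nth.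
  by move=> [i [p t]] [j [q u]] _ _ /= [-> -> ->].
suff uniq_tree : (forall t, uniq (tree_vertices t)) /\
    (forall f t, t \in f -> uniq (tree_vertices t)).
  by split=> [|f]; [exact: uniq_tree.1|apply: uniq_graft; exact: uniq_tree.2].
apply: ptree_forest_ind => [a ts IH||t ts IHt IH u] //.
- rewrite /= -/(forest_vertices ts) uniq_graft // andbT.
  by rewrite mem_forest_vertices.
- by rewrite in_cons => /orP[/eqP -> //|]; apply: IH.
Qed.

Lemma forest_vertices_enum f :
  perm_eq [seq val v | v <- index_enum (vertex f)] (forest_vertices f).
Proof.
apply: uniq_perm; last 1 first.
- move=> v; apply/mapP/idP => [[w _ ->]|fv]; first exact: valP.
  by exists (SeqSub fv); rewrite ?mem_index_enum.
- by rewrite map_inj_uniq ?index_enum_uniq //; apply: val_inj.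
- exact: uniq_vertices.2.
Qed.

End Quotient.

Definition mon_of_word (I : choiceType) (w : seq I) : {cmonom I} :=
  \big[mmul/mone]_(x <- w) ucm x.

Lemma mon_of_wordE (I : choiceType) (w : seq I) x :
  mon_of_word w x = count_mem x w.
Proof.
rewrite /mon_of_word; elim: w => [|y w IHw] /=; first by rewrite big_nil cm1.
by rewrite big_cons cmM IHw cmU.
Qed.

Lemma mon_of_word_perm (I : choiceType) (v w : seq I) :
  mon_of_word v = mon_of_word w -> perm_eq v w.
Proof.
by move=> eq_vw; apply/allP => x _ /=; rewrite -!mon_of_wordE eq_vw.
Qed.

Section Com.
Variable A : finType.
Implicit Types (t u : ptree A) (f g : seq (ptree A)).

Definition com_mon f : {cmonom (letter A)} :=
  \big[mmul/mone]_(v : vertex f) ucm (vdeco v, pred_index (vfert v)).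

Lemma com_mon_iso f g : forest_iso f g -> com_mon f = com_mon g.
Proof.
case/asboolP => phi bij_phi /respectsP[phi_dec phi_edge].
rewrite /com_mon [RHS](reindex phi) /=; last exact: onW_bij.
apply: eq_bigr => v _; rewrite phi_dec; congr (ucm (_, pred_index _)).
rewrite !vfertE -(on_card_preimset (onW_bij _ bij_phi)).
by apply: eq_card => w; rewrite !inE phi_edge.
Qed.

Lemma com_mon_word f : com_mon f = mon_of_word (fer_words f).
Proof.
rewrite /com_mon /mon_of_word -fer_words_vertices big_map.
by rewrite -(perm_big _ (forest_vertices_enum f)) /= big_map.
Qed.
End Com.

Section Monomials.
Variable A : finType.

Definition wt_mon (M : {cmonom (letter A)}) : int :=
  \sum_(x <- finsupp M) wt x *+ M x.

(* The monomials of N(A)_{-1}; a commutative monomial forest is an element of *)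
(* {cmonom Nmon}, so that ucm M is the forest with the single entry M.        *)
Definition Nmon : Type := {M : {cmonom (letter A)} | wt_mon M == -1}.
HB.instance Definition _ := Choice.on Nmon.

Definition sigma_mon (M : {cmonom (letter A)}) : nat :=
  (\prod_(x <- finsupp M) (M x)`!)%N.

Definition sigma_w (F : {cmonom Nmon}) : nat :=
  (\prod_(M <- finsupp F) ((F M)`! * sigma_mon (val M) ^ F M))%N.

Definition Ab (w : Vword A) : {cmonom (letter A)} := mon_of_word (val w).

Definition Phi_com (tau : ntree A) : {cmonom (letter A)} :=
  com_mon [:: generic_quotient.repr tau].

Definition forget_planar (f : seq (ptree A)) : {cmonom (ntree A)} :=
  mon_of_word (map (@nclass A) f).

Definition forest_repr (F : {cmonom (ntree A)}) : seq (ptree A) :=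
  flatten [seq nseq (F tau) (generic_quotient.repr tau) | tau <- finsupp F].

(* The order of the automorphism group of any ordered forest representing F *)
Definition sigma_t (F : {cmonom (ntree A)}) : nat := #|forest_aut (forest_repr F)|.

Lemma forest_reprK : cancel forest_repr forget_planar.
Proof.
move=> F; apply/eqP/cmP => tau; rewrite /forget_planar mon_of_wordE map_flatten.
rewrite -map_comp count_flatten -map_comp sumnE big_map.
rewrite (eq_bigr (fun i => (i == tau) * F i)%N); last first.
  by move=> i _ /=; rewrite map_nseq nclass_repr count_nseq.
case: (boolP (tau \in finsupp F)) => [F_tau|].
  rewrite (bigD1_seq tau F_tau (fset_uniq _)) /= eqxx mul1n.
  by rewrite big1 ?addn0 // => i /negPf ->.
rewrite -cmE_eq0 => /eqP F0; rewrite F0 big1 // => i _.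
by case: eqP => // ->; rewrite F0.
Qed.

Lemma Phi_com_nclass (t : ptree A) : Phi_com (nclass t) = mon_of_word (fer_word t).
Proof.
have /com_mon_iso eq_t : forest_iso [:: generic_quotient.repr (nclass t)] [:: t].
  by apply/nclassP; rewrite nclass_repr.
by rewrite /Phi_com eq_t com_mon_word /fer_words /= cats0.
Qed.

(* The sums over classical sets below are the library's finitely supported    *)
(* sums; these lemmas show that the index sets are indeed finite.             *)
Lemma finite_words (m : {cmonom (letter A)}) :
  finite_set [set w : seq (letter A) | mon_of_word w = m].
Proof.
have [->|/set0P[w0 /= def_m]] := eqVneq [set w | mon_of_word w = m]%classic set0%classic.
  exact: finite_set0.
apply: sub_finite_set (finite_seq (permutations w0)) => w /= def_w.
by rewrite /= mem_permutations; apply: mon_of_word_perm; rewrite def_m.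
Qed.

Lemma finite_Ab (m : {cmonom (letter A)}) :
  finite_set [set w : Vword A | Ab w = m].
Proof.
apply: (@finite_preimage _ _ _ (val : Vword A -> _)) (finite_words m).
by move=> v w _ _; apply: val_inj.
Qed.

Lemma finite_Phi_com (m : {cmonom (letter A)}) :
  finite_set [set tau : ntree A | Phi_com tau = m].
Proof.
apply: sub_finite_set (finite_image (fun w => nclass (Phi_fer_inv w)) (finite_Ab m)).
move=> tau /= def_m; exists (Phi_fer (generic_quotient.repr tau)).
  by rewrite -def_m -[in RHS](nclass_repr tau) Phi_com_nclass.
by rewrite Phi_ferK nclass_repr.
Qed.

Lemma finite_forget_planar (F : {cmonom (ntree A)}) :
  finite_set [set f : seq (ptree A) | forget_planar f = F].
Proof.
have [->|/set0P[f0 /= def_F]] := eqVneq [set f | forget_planar f = F]%classic set0%classic.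
  exact: finite_set0.
apply: sub_finite_set
  (finite_preimage (in2W (@fer_words_inj A)) (finite_words (mon_of_word (fer_words f0)))).
move=> f /= def_f; rewrite /preimage /=.
have : perm_eq (map (@nclass A) f) (map (@nclass A) f0).
  by apply: mon_of_word_perm; rewrite -/(forget_planar f) def_f.
have fer_com g : mon_of_word (fer_words g) =
    \big[mmul/mone]_(tau <- map (@nclass A) g) Phi_com tau.
  rewrite big_map /mon_of_word /fer_words big_flatten big_map /=.
  by apply: eq_bigr => t _; rewrite Phi_com_nclass.
by move=> eq_f; rewrite !fer_com (perm_big _ eq_f).
Qed.

End Monomials.

Notation H_LOT k A := {malg k[{cmonom (Nmon A)}]}.
Notation H_BCK k A := {malg k[{cmonom (ntree A)}]}.
Notation H_PLOT k A := (shuffle_alg k (Vword A)).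
Notation H_MKW k A := (shuffle_alg k (ptree A)).

Section Maps.
Context {k : fieldType} {A : finType}.

Definition Jmap : H_PLOT k A -> H_MKW k A :=
  lin_ext (fun ws : seq (Vword A) => << map (@Phi_fer_inv A) ws >> : H_MKW k A).

Definition Omega_t : H_BCK k A -> H_MKW k A :=
  lin_ext (fun F : {cmonom (ntree A)} =>
    (sigma_t F)%:R *:
    \sum_(f \in [set f : seq (ptree A) | forget_planar f = F]) (<< f >> : H_MKW k A)).

Definition j_monomial (M : Nmon A) : H_BCK k A :=
  \sum_(tau \in [set tau : ntree A | Phi_com tau = val M])
    ((sigma_w (ucm M))%:R / (sigma_t (ucm tau))%:R : k) *:
      (<< ucm tau >> : H_BCK k A).

Definition jmap : H_LOT k A -> H_BCK k A := poly_ext j_monomial.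

Definition Omega_w_monomial (M : Nmon A) : H_PLOT k A :=
  (sigma_w (ucm M))%:R *:
  \sum_(w \in [set w : Vword A | Ab w = val M]) (<< [:: w] >> : H_PLOT k A).

Definition Omega_w : H_LOT k A -> H_PLOT k A := poly_ext Omega_w_monomial.

HB.instance Definition _ := GRing.Linear.on Jmap.
HB.instance Definition _ := GRing.Linear.on Omega_t.
HB.instance Definition _ := GRing.LRMorphism.on jmap.
HB.instance Definition _ := GRing.LRMorphism.on Omega_w.

End Maps.

(* Main.v *)
Require Import Defs.
From HB Require Import structures.
From mathcomp Require Import all_boot all_order all_algebra finmap.
From mathcomp Require Import fingroup perm zify.
From mathcomp Require Import boolp cardinality fsbigop.
From mathcomp.multinomials Require Import monalg.
Import GRing.Theory.
Set Implicit Arguments.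
Unset Strict Implicit.
Unset Printing Implicit Defensive.
Local Open Scope ring_scope.

(** All four maps are morphisms of commutative algebras, and the algebra at the
    source of the square is a polynomial algebra, so it is enough to compare
    both composites on its generators, the monomials [M] of weight -1.  There
    the symmetry factors in the denominators of [jmap] cancel those introduced
    by [Omega_t], and both sides become [sigma_w (ucm M)] times the sum of the
    planar trees whose word abelianizes to [M] ([square_generator]).

    The point that needs work is the multiplicativity of [Omega_t]: the shuffle
    product of the planar representatives of a tree [tau] and of a forest [F]
    yields each planar representative of [tau] times [F] once for each of its
    trees in the class [tau] ([mcoeff_mul_letters]), that is, [(F tau).+1]
    times.  This multiplicity has to be the ratio of the symmetry factor of the
    product to the product of the symmetry factors ([sigma_tM]).

    The recurrence for symmetry factors comes from counting isomorphisms
    between ordered forests [t :: f] and [g] ([card_isoms_cons]): the root of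
    [t] goes to the root of some tree of [g]; trees being connected components,
    the isomorphism then splits into one from [t] to that tree and one from [f]
    to the rest of [g]. *)

(** * Isomorphisms of decorated digraphs *)

(** The isomorphisms of forests used for symmetry factors only see the
    decorations and the parent relation of a forest.  Keeping just these two
    makes it possible to compare a forest with a disjoint sum of smaller ones,
    which has no addresses of its own. *)
Record dgraph (D : Type) := DGraph {
  gvertex :> finType;
  gdeco : gvertex -> D;
  gedge : rel gvertex
}.

Section DGraph.
Variable D : Type.
Implicit Types X Y Z : dgraph D.

Definition is_isom X Y (h : X -> Y) : Prop :=
  [/\ bijective h, forall v, gdeco (h v) = gdeco v
    & forall u v, gedge (h u) (h v) = gedge u v].

Lemma is_isom_comp X Y Z (h : Y -> Z) (h' : X -> Y) :
  is_isom h -> is_isom h' -> is_isom (h \o h').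
Proof.
case=> bij_h decoh edgeh [bij_h' decoh' edgeh']; split=> [|v|u v] /=.
- exact: bij_comp.
- by rewrite decoh decoh'.
- by rewrite edgeh edgeh'.
Qed.

Lemma is_isom_inv X Y (h : X -> Y) :
  is_isom h -> exists h' : Y -> X, [/\ is_isom h', cancel h h' & cancel h' h].
Proof.
case=> -[h' hK h'K] decoh edgeh; exists h'; split=> //; split=> [|v|u v].
- by exists h.
- by rewrite -decoh h'K.
- by rewrite -edgeh !h'K.
Qed.

Lemma eq_is_isom X Y (h h' : X -> Y) : h =1 h' -> is_isom h -> is_isom h'.
Proof. by move=> /funext ->. Qed.

Definition isoms X Y : {set {ffun X -> Y}} :=
  finset (fun h : {ffun X -> Y} => `[< is_isom h >]).

Lemma isomsP X Y (h : {ffun X -> Y}) : reflect (is_isom h) (h \in isoms X Y).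
Proof. by rewrite inE; apply: asboolP. Qed.

Lemma isoms_finfun X Y (h : X -> Y) : is_isom h -> finfun h \in isoms X Y.
Proof. by move=> iso_h; apply/isomsP; apply: eq_is_isom iso_h => x; rewrite ffunE. Qed.

Lemma card_isoms_gt0 X Y :
  (0 < #|isoms X Y|)%N <-> (exists h : X -> Y, is_isom h).
Proof.
rewrite card_gt0; split=> [/set0Pn[h /isomsP]|[h iso_h]]; first by exists h.
by apply/set0Pn; exists (finfun h); apply: isoms_finfun.
Qed.

Lemma leq_card_isoms X X' Y Y' (h : X' -> X) (k : Y -> Y') :
  is_isom h -> is_isom k -> (#|isoms X Y| <= #|isoms X' Y'|)%N.
Proof.
move=> iso_h iso_k; pose c (p : {ffun X -> Y}) := [ffun x => k (p (h x))].
have [[[h' _ h'K] _ _] [bij_k _ _]] := (iso_h, iso_k).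
have inj_c : injective c.
  move=> p q /ffunP eq_pq; apply/ffunP => x; apply: (bij_inj bij_k).
  by have := eq_pq (h' x); rewrite !ffunE h'K.
rewrite -(card_imset _ inj_c); apply/subset_leq_card/subsetP => q /imsetP[p].
move=> /isomsP iso_p ->; apply: (@isoms_finfun _ _ (k \o (p \o h))).
exact/is_isom_comp/is_isom_comp.
Qed.

(** Composition with fixed isomorphisms injects one set into the other, and
    so does composition with their inverses. *)
Lemma card_isoms_transport X X' Y Y' (h : X' -> X) (k : Y' -> Y) :
  is_isom h -> is_isom k -> #|isoms X Y| = #|isoms X' Y'|.
Proof.
move=> iso_h iso_k; have [h' [iso_h' _ _]] := is_isom_inv iso_h.
have [k' [iso_k' _ _]] := is_isom_inv iso_k.
apply/eqP; rewrite eqn_leq (leq_card_isoms iso_h iso_k').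
exact: (leq_card_isoms iso_h' iso_k).
Qed.

(** Adding a predicate to the decoration turns the isomorphisms that carry a
    given set of vertices onto another one into plain isomorphisms, so that
    [card_isoms_transport] applies to them. *)
Definition mark X (m : pred X) : dgraph (bool * D) :=
  DGraph (fun x => (m x, gdeco x)) (@gedge _ X).

(** Disjoint sum, the mark recording the summand; there is no edge between the
    summands. *)
Definition marked_sum X Y : dgraph (bool * D) :=
  @DGraph _ (X + Y)%type
    (fun z => match z with inl x => (true, gdeco x) | inr y => (false, gdeco y) end)
    (fun z z' => match z, z' with
                 | inl x, inl x' => gedge x x'
                 | inr y, inr y' => gedge y y'
                 | _, _ => false
                 end).

End DGraph.

Section MarkedSum.
Variable D : Type.
Implicit Types X Y Z : dgraph D.

Lemma is_isom_mark X Y (m : pred X) (n : pred Y) (h : X -> Y) :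
  @is_isom _ (mark m) (mark n) h <-> is_isom h /\ (forall x, n (h x) = m x).
Proof.
split=> [[bij_h deco_h edge_h]|[[bij_h deco_h edge_h] mark_h]].
  split=> [|x]; last by have [] := deco_h x.
  by split=> // x; have [] := deco_h x.
by split=> //= x; rewrite mark_h deco_h.
Qed.

Lemma isom_marked_sum_split X1 X2 Y1 Y2 (h : marked_sum X1 X2 -> marked_sum Y1 Y2) :
  is_isom h -> exists (a : X1 -> Y1) (b : X2 -> Y2),
    (forall x, h (inl x) = inl (a x)) /\ (forall x, h (inr x) = inr (b x)).
Proof.
case=> _ deco_h _.
have /fin_all_exists[a aP] (x : X1) : exists y, h (inl x) = inl y.
  by case: (h (inl x)) (deco_h (inl x)) => // y _; exists y.
have /fin_all_exists[b bP] (x : X2) : exists y, h (inr x) = inr y.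
  by case: (h (inr x)) (deco_h (inr x)) => // y _; exists y.
by exists a, b.
Qed.

Definition sum_map X1 X2 Y1 Y2 (p : {ffun X1 -> Y1} * {ffun X2 -> Y2}) :
    {ffun marked_sum X1 X2 -> marked_sum Y1 Y2} :=
  [ffun z => match z with inl x => inl (p.1 x) | inr x => inr (p.2 x) end].

Lemma sum_map_inj X1 X2 Y1 Y2 : injective (@sum_map X1 X2 Y1 Y2).
Proof.
move=> [a b] [a' b'] /ffunP eq_p; congr (_, _); apply/ffunP => x.
  by have := eq_p (inl x); rewrite !ffunE => -[].
by have := eq_p (inr x); rewrite !ffunE => -[].
Qed.

(** The mark forbids mixing the two summands, hence an isomorphism is the same
    as a pair of isomorphisms. *)
Lemma card_isoms_marked_sum X1 X2 Y1 Y2 :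
  #|isoms (marked_sum X1 X2) (marked_sum Y1 Y2)| =
  (#|isoms X1 Y1| * #|isoms X2 Y2|)%N.
Proof.
rewrite -cardsX -(card_imset _ (@sum_map_inj X1 X2 Y1 Y2)).
apply: eq_card => h; apply/isomsP/imsetP => [iso_h|[[a b] /[!inE]]]; last first.
  case/andP=> /asboolP[[a' aK a'K] deco_a edge_a].
  case/asboolP=> [[b' bK b'K] deco_b edge_b] ->; split.
  - exists (fun z => match z with inl x => inl (a' x) | inr x => inr (b' x) end).
      by case=> x; rewrite ffunE /= ?aK ?bK.
    by case=> x; rewrite ffunE /= ?a'K ?b'K.
  - by case=> x; rewrite ffunE /= ?deco_a ?deco_b.
  - by case=> x; case=> y; rewrite !ffunE /= ?edge_a ?edge_b.
have [a [b [def_a def_b]]] := isom_marked_sum_split iso_h.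
have [h' [iso_h' hK h'K]] := is_isom_inv iso_h.
have [a' [b' [def_a' def_b']]] := isom_marked_sum_split iso_h'.
have [_ deco_h edge_h] := iso_h.
exists (finfun a, finfun b); last first.
  by apply/ffunP => -[x|x]; rewrite ?def_a ?def_b !ffunE.
rewrite finset.in_setX; apply/andP; split; apply: isoms_finfun; split.
- exists a' => x.
    by apply: (@inl_inj X1 X2); rewrite -def_a' -def_a hK.
  by apply: (@inl_inj Y1 Y2); rewrite -def_a -def_a' h'K.
- by move=> x; have := deco_h (inl x); rewrite def_a => -[].
- by move=> x y; have := edge_h (inl x) (inl y); rewrite !def_a.
- exists b' => x.
    by apply: (@inr_inj X1 X2); rewrite -def_b' -def_b hK.
  by apply: (@inr_inj Y1 Y2); rewrite -def_b -def_b' h'K.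
- by move=> x; have := deco_h (inr x); rewrite def_b => -[].
- by move=> x y; have := edge_h (inr x) (inr y); rewrite !def_b.
Qed.

End MarkedSum.

(** * Splitting a tree off an ordered forest *)

Definition rem_at (T : Type) (i : nat) (s : seq T) : seq T := take i s ++ drop i.+1 s.

Lemma nth_rem_at (T : Type) (x0 : T) i s j :
  nth x0 (rem_at i s) j = nth x0 s (bump i j).
Proof.
rewrite /rem_at nth_cat size_take_min nth_drop /bump.
case: (leqP i j) => [le_ij|lt_ji].
  rewrite (_ : (j < minn i (size s))%N = false) /=; last by lia.
  case: (leqP i (size s)) => le_i; first by congr (nth _ _ _); lia.
  by rewrite !nth_default //; lia.
case: ltnP => [lt_j|le_j]; first by rewrite nth_take.
by rewrite !nth_default //; lia.
Qed.

Lemma map_rem_at (T U : Type) (h : T -> U) i s : map h (rem_at i s) = rem_at i (map h s).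
Proof. by rewrite map_cat map_take map_drop. Qed.

Lemma perm_rem_at (T : eqType) (x0 : T) i s :
  (i < size s)%N -> perm_eq s (nth x0 s i :: rem_at i s).
Proof.
move=> lt_i; rewrite -[X in perm_eq X _](cat_take_drop i) (drop_nth x0) //.
by rewrite -cat1s perm_catCA.
Qed.

Section ForestGraph.
Variable A : finType.
Implicit Types (t : ptree A) (f g : seq (ptree A)).

Definition forest_graph f : dgraph A := DGraph (@vdeco A f) (@edge A f).

Lemma forest_isoP f g :
  reflect (exists h : forest_graph f -> forest_graph g, is_isom h) (forest_iso f g).
Proof.
apply: (iffP (asboolP _)) => [[h bij_h /respectsP[]]|[h [bij_h deco_h edge_h]]].
  by exists h.
by exists h => //; apply/respectsP.
Qed.

Lemma card_forest_aut f : #|forest_aut f| = #|isoms (forest_graph f) (forest_graph f)|.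
Proof.
pose c (s : {perm vertex f}) : {ffun forest_graph f -> forest_graph f} := [ffun x => s x].
have inj_c : injective c.
  by move=> s s' /ffunP eq_c; apply/permP => x; have := eq_c x; rewrite !ffunE.
rewrite -(card_imset _ inj_c); apply: eq_card => h.
apply/imsetP/isomsP => [[s /[!inE] /respectsP[deco_s edge_s] ->]|].
  split=> [|v|u v].
  - exists (fun x => s^-1%g x : vertex f) => x; rewrite ffunE ?permK //; apply: permKV.
  - by rewrite ffunE; apply: deco_s.
  - by rewrite !ffunE; apply: edge_s.
case=> bij_h deco_h edge_h; exists (perm (bij_inj bij_h)).
  rewrite inE; apply/respectsP.
  by split=> [v|u v] /[!permE]; [exact: deco_h|exact: edge_h].
by apply/ffunP => x; rewrite ffunE permE.
Qed.

(** The position, in the forest, of the tree that contains the vertex. *)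
Definition tree_index f (v : vertex f) : nat := head 0%N (val v).1.

Lemma addressE f (v : vertex f) : (val v).1 = tree_index v :: behead (val v).1.
Proof. by have := vertex_subtree v; rewrite /tree_index; case: (val v).1. Qed.

Lemma mem_vertices f i p t :
  ((i :: p, t) \in forest_vertices f) = ((p, t) \in nth [::] (map (@tree_vertices A) f) i).
Proof. exact: mem_graft. Qed.

Lemma mem_vertex f (v : vertex f) :
  (behead (val v).1, (val v).2) \in nth [::] (map (@tree_vertices A) f) (tree_index v).
Proof. by rewrite -mem_vertices -addressE -surjective_pairing; apply: valP. Qed.

Lemma tree_index_lt f (v : vertex f) : (tree_index v < size f)%N.
Proof.
have := mem_vertex v; case: (ltnP (tree_index v)) => // le_v.
by rewrite nth_default // size_map.
Qed.

Lemma edgeE f (u v : vertex f) :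
  edge u v = [&& tree_index u == tree_index v,
    size (behead (val v).1) == (size (behead (val u).1)).+1
    & prefix (behead (val u).1) (behead (val v).1)].
Proof. by rewrite /edge (addressE u) (addressE v) /= eqSS andbCA. Qed.

Lemma vertex_inj f (u v : vertex f) : (val u).1 = (val v).1 -> u = v.
Proof.
move=> eq_uv; apply: val_inj; have := vertex_subtree u.
rewrite eq_uv vertex_subtree => -[eq2].
by rewrite (surjective_pairing (val u)) (surjective_pairing (val v)) eq_uv eq2.
Qed.

Lemma parent_vertex f (v : vertex f) p i :
  behead (val v).1 = rcons p i ->
  exists w : vertex f, [/\ behead (val w).1 = p, tree_index w = tree_index v & edge w v].
Proof.
move=> def_p; have := vertex_subtree v.
rewrite addressE def_p -rcons_cons /= foldl_rcons.
case def_t: (foldl _ _ _) => [t|] //= _.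
have wP : (tree_index v :: p, t) \in forest_vertices f by rewrite mem_forest_vertices /= def_t.
exists (SeqSub wP); split=> //; rewrite edgeE /= def_p size_rcons eqxx.
by rewrite /tree_index /= eqxx prefix_rcons.
Qed.

(** The trees of a forest are the connected components of its parent relation:
    every vertex is linked by a chain of edges to the root of its tree. *)
Lemma edge_connected f (T : Type) (h : vertex f -> T) :
  (forall u v, edge u v -> h u = h v) ->
  forall u v, tree_index u = tree_index v -> h u = h v.
Proof.
move=> edge_h.
suff to_root (r v : vertex f) :
    behead (val r).1 = [::] -> tree_index r = tree_index v -> h r = h v.
  move=> u v eq_uv; have lt_u := tree_index_lt u.
  pose t := nth (val u).2 f (tree_index u).
  have rP : ([:: tree_index u], t) \in forest_vertices f.
    rewrite mem_vertices (nth_map (val u).2) //.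
    by rewrite -/t; case: (t) => a ts /=; rewrite mem_head.
  by rewrite -(to_root (SeqSub rP) u) // -(to_root (SeqSub rP) v).
move=> r0; have [p def_p] : exists p, p = behead (val v).1 by exists (behead (val v).1).
elim/last_ind: p v def_p => [|p i IHp] v def_p eq_rv.
  suff -> : r = v by [].
  by apply: vertex_inj; rewrite (addressE r) (addressE v) eq_rv r0 -def_p.
have [w [def_w eq_wv edge_wv]] := parent_vertex (esym def_p).
by rewrite -(edge_h _ _ edge_wv); apply: IHp; rewrite ?def_w ?eq_wv.
Qed.

(** An isomorphism permutes the trees as blocks, because the tree of a vertex
    is a connected component; the converse implication is the same fact for the
    inverse. *)
Lemma isom_tree_index f g (h : forest_graph f -> forest_graph g) :
  is_isom h ->
  forall u v, (tree_index (h u) == tree_index (h v)) = (tree_index u == tree_index v).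
Proof.
have tree_index_le f' g' (k : forest_graph f' -> forest_graph g') :
    is_isom k ->
    forall u v, tree_index u = tree_index v -> tree_index (k u) = tree_index (k v).
  case=> _ _ edge_k; apply: edge_connected => u v.
  by rewrite -[edge u v]/(gedge (u : forest_graph f') v) -edge_k /= edgeE => /and3P[/eqP].
move=> iso_h u v; have [h' [iso_h' hK _]] := is_isom_inv iso_h.
apply/eqP/eqP => [eq_h|]; last exact: tree_index_le.
by rewrite -(hK u) -(hK v); apply: tree_index_le.
Qed.

Section Split.
Variables (t0 : ptree A) (g : seq (ptree A)) (i : nat).
Hypothesis lt_i : (i < size g)%N.

(** In terms of addresses: those of the lone tree change their first coordinate
    from [0] to [i], and those of the remaining forest skip the value [i] by
    means of [bump i]. *)
Lemma isom_split_forest :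
  exists h : marked_sum (forest_graph [:: nth t0 g i]) (forest_graph (rem_at i g)) ->
      mark (X := forest_graph g) (fun v => tree_index v == i),
    is_isom h.
Proof.
set X1 := forest_graph _; set X2 := forest_graph _.
pose target (z : X1 + X2) : seq nat * ptree A := match z with
  | inl x => (i :: behead (val x).1, (val x).2)
  | inr x => (bump i (tree_index x) :: behead (val x).1, (val x).2)
  end.
have index1 (x : X1) : tree_index x = 0%N by have := tree_index_lt x; case: (tree_index x).
have [|h hP] := @fin_all_exists (X1 + X2)%type (fun=> vertex g) (fun z v => val v = target z).
  case=> x.
    have xP : (i :: behead (val x).1, (val x).2) \in forest_vertices g.
      have := mem_vertex x; rewrite index1 mem_vertices /= => ?.
      by rewrite (nth_map t0).
    by exists (SeqSub xP).
  have xP : (bump i (tree_index x) :: behead (val x).1, (val x).2) \in forest_vertices g.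
    have := mem_vertex x; rewrite mem_vertices map_rem_at nth_rem_at; exact.
  by exists (SeqSub xP).
have h_inj : injective h.
  move=> x y /(congr1 val); rewrite !hP; case: x y => x [] y /= [].
  - move=> eq_b _; congr inl; apply: vertex_inj.
    by rewrite (addressE x) (addressE y) !index1 eq_b.
  - by move/eqP; rewrite (negPf (neq_bump _ _)).
  - by move/eqP; rewrite eq_sym (negPf (neq_bump _ _)).
  - move/(can_inj (@bumpK i)) => eq_t eq_b _; congr inr; apply: vertex_inj.
    by rewrite (addressE x) (addressE y) eq_t eq_b.
have h_surj (v : vertex g) : exists z, h z = v.
  have := mem_vertex v; case: (eqVneq (tree_index v) i) => [eq_v|ne_v].
    rewrite eq_v (nth_map t0) // => vP.
    have xP : (0%N :: behead (val v).1, (val v).2) \in forest_vertices [:: nth t0 g i].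
      by rewrite mem_vertices.
    exists (inl (SeqSub xP)); apply: vertex_inj.
    by rewrite hP /= addressE eq_v.
  rewrite -(unbumpK ne_v) -nth_rem_at -map_rem_at -mem_vertices => xP.
  exists (inr (SeqSub xP)); apply: vertex_inj.
  by rewrite hP /= /tree_index /= [RHS]addressE unbumpK.
have [h' h'K] := fin_all_exists h_surj.
exists h; split=> [|z|z z'].
- by exists h' => z; [apply: h_inj; rewrite h'K|rewrite h'K].
- rewrite /= /tree_index /vdeco hP; case: z => x /=; first by rewrite eqxx.
  by rewrite eq_sym (negPf (neq_bump _ _)).
- rewrite /= edgeE /tree_index !hP.
  case: z z' => x [] y /=; rewrite ?[X in _ = X]edgeE ?index1 ?eqxx //.
  + by rewrite (negPf (neq_bump _ _)).
  + by rewrite eq_sym (negPf (neq_bump _ _)).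
  + by rewrite (inj_eq (can_inj (@bumpK i))).
Qed.

End Split.

(** Isomorphisms are sorted by the index [i] of the tree that receives the root
    of [t]: those with index [i] carry the whole of [t] onto that tree and [f]
    onto the remaining ones. *)
Lemma card_isoms_cons t f t0 g :
  #|isoms (forest_graph (t :: f)) (forest_graph g)| =
  (\sum_(i < size g) #|isoms (forest_graph [:: t]) (forest_graph [:: nth t0 g i])| *
                     #|isoms (forest_graph f) (forest_graph (rem_at i g))|)%N.
Proof.
have rP : ([:: 0%N], t) \in forest_vertices (t :: f).
  by rewrite mem_vertices /=; case: (t) => a ts /=; rewrite mem_head.
pose r : forest_graph (t :: f) := SeqSub rP.
pose image_root (h : {ffun forest_graph (t :: f) -> forest_graph g}) :=
  Ordinal (tree_index_lt (h r)).
rewrite -sum1_card (partition_big image_root xpredT) //=; apply: eq_bigr => i _.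
have := @isom_split_forest t (t :: f) 0%N isT.
rewrite [rem_at _ _](_ : _ = f); last by rewrite /rem_at /= drop0.
case=> k iso_k.
have [k' iso_k'] := @isom_split_forest t0 g i (ltn_ord i).
have := card_isoms_marked_sum (forest_graph [:: t]) (forest_graph f)
  (forest_graph [:: nth t0 g i]) (forest_graph (rem_at i g)).
rewrite -(card_isoms_transport iso_k iso_k') => <-; rewrite sum1_card.
(* Sending the root of [t] into tree [i] is the same as matching the marks:    *)
(* the vertices of [t] are exactly those that go to tree [i].                  *)
apply: eq_card => h; rewrite unfold_in.
have isoP := @isomsP _ (forest_graph (t :: f)) (forest_graph g) h.
apply/andP/(@isomsP _ (mark _) (mark _)) => [[/isoP iso_h /eqP/(congr1 val) /= def_i]|].
  by apply/is_isom_mark; split=> // x; rewrite -def_i; apply: (isom_tree_index iso_h x r).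
case/is_isom_mark=> /isoP iso_h mark_h; split=> //.
by rewrite -val_eqE /= mark_h.
Qed.

End ForestGraph.

(** * The symmetry factor of a forest *)

Section AutCount.
Variable A : finType.
Implicit Types (t : ptree A) (f g : seq (ptree A)).

Local Notation niso f g := #|isoms (forest_graph f) (forest_graph g)|.

Lemma forest_iso_card f g : forest_iso f g = (0 < niso f g)%N.
Proof. by apply/forest_isoP/idP => /card_isoms_gt0. Qed.

Lemma niso_iso f f' g g' :
  forest_iso f f' -> forest_iso g g' -> niso f g = niso f' g'.
Proof.
move=> /forest_iso_sym/forest_isoP[h iso_h] /forest_iso_sym/forest_isoP[k iso_k].
exact: card_isoms_transport iso_h iso_k.
Qed.

Lemma nclass_eq t u : (nclass t == nclass u) = forest_iso [:: t] [:: u].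
Proof. by apply/eqP/idP => /nclassP. Qed.

(** Some term of the sum in [card_isoms_cons] is nonzero: the one indexed by
    the first tree of [g] in the class of [t]. *)
Lemma perm_nclass_iso f g :
  perm_eq (map (@nclass A) f) (map (@nclass A) g) -> forest_iso f g.
Proof.
elim: f g => [|t f IHf] g eq_fg.
  have -> : g = [::] by apply/nilP; have := perm_size eq_fg; rewrite /= size_map /nilp => <-.
  exact: forest_iso_refl.
have lt_t : (index (nclass t) (map (@nclass A) g) < size g)%N.
  by rewrite -(size_map (@nclass A)) index_mem -(perm_mem eq_fg) /= mem_head.
rewrite forest_iso_card (card_isoms_cons _ _ t) (bigD1 (Ordinal lt_t)) //= addn_gt0 muln_gt0.
have eq_t : nth (nclass t) (map (@nclass A) g) (index (nclass t) (map (@nclass A) g)) = nclass t.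
  by rewrite nth_index // -(perm_mem eq_fg) /= mem_head.
rewrite -!forest_iso_card -nclass_eq -(nth_map _ (nclass t)) // eq_t eqxx /= IHf //.
rewrite map_rem_at -(perm_cons (nclass t)) (permPl eq_fg) -[X in X :: _]eq_t.
by apply: perm_rem_at; rewrite size_map.
Qed.

(** In the sum of [card_isoms_cons], the trees outside the class of [t]
    contribute nothing.  The others all contribute the same number, because
    removing any of them leaves a forest isomorphic to [f]. *)
Lemma card_forest_aut_cons t f :
  #|forest_aut (t :: f)| =
  (count_mem (nclass t) (map (@nclass A) (t :: f)) *
    (#|forest_aut [:: t]| * #|forest_aut f|))%N.
Proof.
rewrite !card_forest_aut (card_isoms_cons _ _ t) -sum1_count big_map (big_nth t) big_mkord.
rewrite big_distrl /= [RHS]big_mkcond; apply: eq_bigr => i _.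
case: ifP => [/eqP eq_t|]; last first.
  rewrite nclass_eq => /negbT niso_i; apply/eqP; rewrite muln_eq0 -leqn0 leqNgt.
  by rewrite -forest_iso_card (contra _ niso_i) //; apply: forest_iso_sym.
rewrite mul1n; congr (_ * _)%N; apply: niso_iso; try exact: forest_iso_refl.
  by rewrite -nclass_eq eq_t.
apply: perm_nclass_iso.
rewrite map_rem_at -(perm_cons (nclass t)) -[X in perm_eq (X :: _) _]eq_t.
rewrite -(nth_map _ (nclass t)) // perm_sym.
by apply: (@perm_rem_at _ _ i (map (@nclass A) (t :: f))); rewrite size_map.
Qed.

Lemma forget_planar_cons t f :
  forget_planar (t :: f) = mmul (ucm (nclass t)) (forget_planar f).
Proof. exact: big_cons. Qed.

Lemma sigma_t_forget f : sigma_t (forget_planar f) = #|forest_aut f|.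
Proof.
have iso_f : forest_iso (forest_repr (forget_planar f)) f.
  by apply/perm_nclass_iso/mon_of_word_perm; apply: forest_reprK.
by rewrite /sigma_t !card_forest_aut; apply: niso_iso.
Qed.

Lemma sigma_t_cons t f :
  sigma_t (forget_planar (t :: f)) =
  (count_mem (nclass t) (map (@nclass A) (t :: f)) *
    (sigma_t (ucm (nclass t)) * sigma_t (forget_planar f)))%N.
Proof.
rewrite !sigma_t_forget card_forest_aut_cons; congr (_ * (_ * _))%N.
by rewrite -sigma_t_forget /forget_planar /mon_of_word /= big_seq1.
Qed.

(** One step of the product formula for the symmetry factor of a multiset of
    trees: the factorials of the multiplicities times the symmetry factors of
    the trees.  The factor [(F tau).+1] is the new multiplicity of [tau]. *)
Lemma sigma_tM (tau : ntree A) (F : {cmonom (ntree A)}) :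
  sigma_t (mmul (ucm tau) F) = ((F tau).+1 * (sigma_t (ucm tau) * sigma_t F))%N.
Proof.
have := sigma_t_cons (generic_quotient.repr tau) (forest_repr F).
rewrite forget_planar_cons nclass_repr forest_reprK => ->.
by rewrite /= nclass_repr eqxx -mon_of_wordE -/(forget_planar _) forest_reprK.
Qed.

End AutCount.

(** * Coefficients of linear extensions *)

Section Coefficients.
Variable k : fieldType.

Lemma sum_delta (K : choiceType) (V : nmodType) (S : {fset K}) (c : K -> V) (m0 : K) :
  \sum_(m <- S) c m *+ (m == m0) = c m0 *+ (m0 \in S).
Proof.
case: (boolP (m0 \in S)) => S_m0.
  rewrite (big_fsetD1 m0) //= eqxx big1_fset ?addr0 // => m.
  by rewrite in_fsetD1 => /andP[/negPf -> _].
rewrite big1_fset // => m S_m _; case: eqP => // eq_m.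
by rewrite eq_m (negPf S_m0) in S_m.
Qed.

Lemma sum_msupp_delta (K : choiceType) (x : {malg k[K]}) (m0 : K) :
  \sum_(m <- msupp x) x@_m *+ (m == m0) = x@_m0.
Proof. by rewrite sum_delta -mcoeff_neq0; case: eqP => [->|]. Qed.

Lemma mcoeff_lin_ext (K L : choiceType) (h : K -> {malg k[L]}) x g :
  (lin_ext h x)@_g = \sum_(m <- msupp x) x@_m * (h m)@_g.
Proof. by rewrite raddf_sum; apply: eq_bigr => m _ /=; rewrite mcoeffZ. Qed.

Lemma mcoeff_fsbig (T K : choiceType) (D : classical_sets.set T)
    (F : T -> {malg k[K]}) g :
  finite_set D -> (\sum_(t \in D) F t)@_g = \sum_(t <- fset_set D) (F t)@_g.
Proof. by move=> finD; rewrite fsbig_finite //= raddf_sum. Qed.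

Lemma mem_fset_preimage (T : choiceType) (U : eqType) (h : T -> U) u x :
  finite_set (fun x => h x = u) ->
  (x \in fset_set (fun x => h x = u)) = (h x == u).
Proof.
by move=> fin; rewrite in_fset_set //; apply/idP/eqP; rewrite classical_sets.in_setE.
Qed.

Lemma mcoeff_lin_ext_inj (K L : choiceType) (h : K -> L) x m :
  injective h -> (lin_ext (fun m => << h m >> : {malg k[L]}) x)@_(h m) = x@_m.
Proof.
move=> inj_h; rewrite mcoeff_lin_ext -[RHS]sum_msupp_delta.
by apply: eq_bigr => m' _; rewrite mcoeffU (inj_eq inj_h) mulrnAr mulr1.
Qed.

End Coefficients.

(** * Shuffling with letters *)

Section ShuffleLetter.
Variables (k : fieldType) (T : choiceType).
Implicit Types (s g : seq T) (x y : shuffle_alg k T).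

Lemma mcoeff_prefix_nil a x : (prefix_letter a x)@_[::] = 0.
Proof. by rewrite mcoeff_lin_ext big1 // => s _; rewrite mcoeffU mulr0. Qed.

Lemma mcoeff_prefix_cons a x c g : (prefix_letter a x)@_(c :: g) = x@_g *+ (a == c).
Proof.
rewrite mcoeff_lin_ext -[in RHS](sum_msupp_delta x) -sumrMnl; apply: eq_bigr => s _.
by rewrite mcoeffU eqseq_cons mulrnAr mulr1 -mulrnA mulnb andbC.
Qed.

(** Shuffling one letter into [s] inserts it at some position [p]; the words
    obtained are the [g] whose letter at [p] is [a] and whose other letters
    form [s]. *)
Lemma mcoeff_shuffle_letter (x0 : T) a s g :
  (shuffle_words k [:: a] s)@_g =
  \sum_(p < size g) ((a == nth x0 g p) && (s == rem_at p g))%:R.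
Proof.
elim: s g => [|b s IHs] g.
  rewrite shuffles0 mcoeffU; case: g => [|c g]; first by rewrite big_ord0.
  rewrite big_ord_recl /= big1 ?addr0 => [|p _]; last by rewrite andbF.
  by rewrite eqseq_cons /rem_at /= drop0.
rewrite shuffle_cons mcoeffD shuffle0s.
case: g => [|c g]; first by rewrite !mcoeff_prefix_nil addr0 big_ord0.
rewrite !mcoeff_prefix_cons big_ord_recl /= mcoeffU IHs /rem_at /= drop0.
rewrite -mulrnA mulnb andbC; congr (_ + _); rewrite -sumrMnl; apply: eq_bigr => p _.
by rewrite eqseq_cons -mulrnA mulnb -andbA [(b == c) && _]andbC.
Qed.

(** Bilinear form of [mcoeff_shuffle_letter], meant for [x] the image under
    [Omega_t] of a single tree. *)
Lemma mcoeff_mul_letters (x0 : T) x y g :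
  (forall s, x@_s != 0 -> size s = 1%N) ->
  (x * y)@_g = \sum_(p < size g) x@_[:: nth x0 g p] * y@_(rem_at p g).
Proof.
move=> x_letters; rewrite -[x * y]/(shuffle_mul x y) mcoeff_lin_ext.
transitivity (\sum_(s <- msupp x) \sum_(p < size g)
   x@_s *+ (s == [:: nth x0 g p]) * y@_(rem_at p g)).
  rewrite big_seq [RHS]big_seq; apply: eq_bigr => s.
  rewrite -mcoeff_neq0 => /x_letters; case: s => [|a []] // _.
  rewrite mcoeff_lin_ext mulr_sumr.
  under eq_bigr => t _ do rewrite (mcoeff_shuffle_letter x0) !mulr_sumr.
  rewrite exchange_big /=; apply: eq_bigr => p _.
  rewrite eqseq_cons andbT -[in RHS](sum_msupp_delta y) mulr_sumr.
  apply: eq_bigr => t _; case: (a == _); rewrite ?mul0r ?mulr0 //=.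
  by case: (t == _); rewrite ?mulr1 ?mulr0.
by rewrite exchange_big /=; apply: eq_bigr => p _; rewrite -mulr_suml sum_msupp_delta.
Qed.

End ShuffleLetter.

(** * Morphisms from a polynomial algebra *)

Section Monomials.

Lemma mon_of_word_cons (I : choiceType) (i : I) w :
  mon_of_word (i :: w) = mmul (ucm i) (mon_of_word w).
Proof. exact: big_cons. Qed.

Lemma mon_of_word1 (I : choiceType) (i : I) : mon_of_word [:: i] = ucm i.
Proof. exact: big_seq1. Qed.

Lemma mon_of_word_surj (I : choiceType) (m : {cmonom I}) : exists w, m = mon_of_word w.
Proof.
exists (flatten [seq nseq (m i) i | i <- finsupp m]); apply/esym/eqP/cmP => i0.
rewrite mon_of_wordE count_flatten -map_comp sumnE big_map.
rewrite (eq_bigr (fun i => m i *+ (i == i0))).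
  rewrite sum_delta; case: (boolP (i0 \in _)) => //.
  by rewrite -cmE_eq0 => /eqP ->.
by move=> i _ /=; rewrite count_nseq /=; case: eqP; rewrite ?mul1n ?mul0n.
Qed.

Lemma malg_mon_of_word (k : fieldType) (I : choiceType) (w : seq I) :
  << mon_of_word w >> = \prod_(i <- w) << ucm i >> :> {malg k[{cmonom I}]}.
Proof.
elim: w => [|i w IHw]; first by rewrite /mon_of_word !big_nil.
by rewrite big_cons -IHw mon_of_word_cons malgM_def fgmulUU mulr1.
Qed.

Lemma poly_morph_eq (k : fieldType) (I : choiceType) (S : comAlgType k)
    (f g : {lrmorphism {malg k[{cmonom I}]} -> S}) :
  (forall i, f << ucm i >> = g << ucm i >>) -> f =1 g.
Proof.
move=> eq_fg; apply: lin_ext_unique => m; have [w ->] := mon_of_word_surj m.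
rewrite malg_mon_of_word !rmorph_prod; apply: eq_bigr => i _; exact: eq_fg.
Qed.

End Monomials.

(** * The maps of the square *)

Section MainMaps.
Context {k : fieldType} {A : finType}.
Implicit Types (g : seq (ptree A)).

(** [Jmap] merely renames the letters along a bijection. *)
Lemma mcoeff_Jmap (x : H_PLOT k A) g : (Jmap x)@_g = x@_(map (@Phi_fer A) g).
Proof.
rewrite -[in LHS](mapK (@Phi_ferK A) g); apply: mcoeff_lin_ext_inj.
exact/inj_map/can_inj/Phi_fer_invK.
Qed.

Lemma shuffle_map (T U : Type) (h : T -> U) s t :
  shuffle (map h s) (map h t) = map (map h) (shuffle s t).
Proof.
elim: s t => [|a s IHs] t //=; elim: t => [|b t IHt] //=.
by rewrite -[h b :: _]/(map h (b :: t)) IHs IHt map_cat -!map_comp.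
Qed.

Lemma JmapM : {morph (@Jmap k A) : x y / x * y}.
Proof.
move=> x y; rewrite -[LHS]/((Jmap \o shuffle_mull y) x).
rewrite -[RHS]/((shuffle_mull (Jmap y) \o Jmap) x).
apply: lin_ext_unique => s /=; rewrite [Jmap << s >>]lin_extU.
rewrite -[LHS]/((Jmap \o shuffle_mulr << s >>) y).
rewrite -[RHS]/((shuffle_mulr << map (@Phi_fer_inv A) s >> \o Jmap) y).
apply: lin_ext_unique => t /=; rewrite /shuffle_mulr /Jmap lin_extU !shuffle_mulUU.
rewrite linear_sum /shuffle_words shuffle_map big_map; apply: eq_bigr => u _.
exact: lin_extU.
Qed.

Lemma Jmap1 : @Jmap k A 1 = 1.
Proof. exact: lin_extU. Qed.

HB.instance Definition _ := GRing.isMonoidMorphism.Build (H_PLOT k A) (H_MKW k A)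
  (@Jmap k A) (Jmap1, JmapM).

(** [Omega_t] is dual to the forgetful map up to the symmetry factor: an ordered
    forest [g] occurs in the image of exactly one forest, its own class. *)
Lemma mcoeff_Omega_t (x : H_BCK k A) g :
  (Omega_t x)@_g = (sigma_t (forget_planar g))%:R * x@_(forget_planar g).
Proof.
rewrite mcoeff_lin_ext -[in RHS](sum_msupp_delta x) mulr_sumr; apply: eq_bigr => F _.
rewrite mcoeffZ mcoeff_fsbig; last exact: finite_forget_planar.
under eq_bigr => f _ do rewrite mcoeffU.
rewrite sum_delta mem_fset_preimage; last exact: finite_forget_planar.
rewrite eq_sym.
by case: eqP => [->|_]; rewrite ?mulr0 // mulr1 mulrC.
Qed.

Lemma forget_planar_eq_ucm g tau :
  (forget_planar g == ucm tau) = (map (@nclass A) g == [:: tau]).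
Proof.
rewrite -mon_of_word1; apply/eqP/eqP => [/mon_of_word_perm|eq_g].
  exact: perm_small_eq.
by rewrite /forget_planar eq_g.
Qed.

Lemma mon_of_word_eq1 (I : choiceType) (w : seq I) : (mon_of_word w == mone) = (w == [::]).
Proof.
apply/eqP/eqP => [|->]; last exact: big_nil.
rewrite -[mone](big_nil mone mmul xpredT (@ucm I)) -/(mon_of_word _).
by move/mon_of_word_perm/perm_nilP.
Qed.

Lemma card_forest_aut_nil : #|@forest_aut A [::]| = 1%N.
Proof.
apply/eqP; rewrite eqn_leq card_forest_aut_gt0 andbT.
apply/card_le1_eqP => s s' _ _; apply/permP => v.
by have := tree_index_lt v.
Qed.

Lemma Omega_tU1 : Omega_t (<< mone >> : H_BCK k A) = 1.
Proof.
apply/malgP => g; rewrite mcoeff_Omega_t !mcoeffU [_ == forget_planar g]eq_sym.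
rewrite mon_of_word_eq1; case: g => [|t g] /=; last by rewrite mulr0.
by rewrite sigma_t_forget card_forest_aut_nil mulr1.
Qed.

Lemma mcoeff_Omega_tU F g :
  (Omega_t (<< F >> : H_BCK k A))@_g = (sigma_t F)%:R *+ (forget_planar g == F).
Proof.
rewrite mcoeff_Omega_t mcoeffU eq_sym.
by case: eqP => [->|_]; rewrite ?mulr1 ?mulr0.
Qed.

Lemma mmul_ucmI (I : choiceType) (i : I) : injective (mmul (ucm i)).
Proof.
move=> m n eq_mn; apply/eqP/cmP => i'.
have := congr1 (fun m : {cmonom I} => m i') eq_mn.
by rewrite !cmM => /addnI.
Qed.

Lemma forget_planar_rem_at t0 g p : (p < size g)%N ->
  forget_planar g = mmul (ucm (nclass (nth t0 g p))) (forget_planar (rem_at p g)).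
Proof.
move=> lt_p; rewrite -forget_planar_cons; apply: perm_big.
by apply: perm_map; apply: perm_rem_at.
Qed.

(** On both sides the coefficient of [g] vanishes unless [g] represents
    [mmul (ucm tau) F].  In that case the trees of [g] in the class [tau], which
    are [(F tau).+1] in number, each contribute the product of the symmetry
    factors of [tau] and [F] to the shuffle product, and [sigma_tM] says that
    these contributions add up to the symmetry factor of [g]. *)
Lemma Omega_t_ucmM tau (F : {cmonom (ntree A)}) :
  Omega_t (<< mmul (ucm tau) F >> : H_BCK k A) =
  Omega_t (<< ucm tau >> : H_BCK k A) * Omega_t (<< F >> : H_BCK k A).
Proof.
apply/malgP => g; rewrite (mcoeff_mul_letters (generic_quotient.repr tau)); last first.
  move=> s; rewrite mcoeff_Omega_tU forget_planar_eq_ucm.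
  case: (_ =P [:: tau]) => [def_s _|_ /eqP[]] //.
  by have := congr1 size def_s; rewrite size_map.
set t0 := generic_quotient.repr tau.
transitivity (\sum_(p < size g) ((sigma_t (ucm tau) * sigma_t F)%:R : k) *+
    ((nclass (nth t0 g p) == tau) && (forget_planar g == mmul (ucm tau) F))).
  rewrite mcoeff_Omega_tU sumrMnr /=.
  have [def_g|ne_g] := eqVneq; last first.
    by rewrite big1 ?mulr0n // => p _; rewrite andbF.
  under eq_bigr => p _ do rewrite andbT.
  have -> : (\sum_(p < size g) (nclass (nth t0 g p) == tau) = (F tau).+1)%N.
    rewrite -add1n -[1%N](cmUU tau) -cmM -def_g mon_of_wordE.
    by rewrite -sum1_count big_map (big_nth t0) big_mkord [RHS]big_mkcond.
  by rewrite sigma_tM mulnC natrM mulr_natr mulr1n.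
apply: eq_bigr => p _; rewrite !mcoeff_Omega_tU forget_planar_eq_ucm /= eqseq_cons andbT.
case: eqP => [def_tau|_]; last by rewrite mul0r.
rewrite (forget_planar_rem_at t0 (ltn_ord p)) def_tau (inj_eq (@mmul_ucmI _ _)) /=.
(* The comparisons with [F] on the two sides are only convertible.             *)
rewrite natrM mulr1n; set b := (X in _ *+ nat_of_bool X = _).
rewrite -[X in _ = _ * (_ *+ nat_of_bool X)]/b.
by case: b; rewrite ?mulr0 // mulr0n mulr0.
Qed.

(** Multiplicativity follows: [Omega_t] is the algebra morphism determined by
    its values on single trees. *)
Lemma Omega_t_poly_ext :
  @Omega_t k A =1 poly_ext (fun tau => Omega_t (<< ucm tau >> : H_BCK k A)).
Proof.
apply: lin_ext_unique => F; have [w ->] := mon_of_word_surj F.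
rewrite [in RHS]malg_mon_of_word rmorph_prod /=.
under [RHS]eq_bigr => tau _ do rewrite poly_extU.
elim: w => [|tau w IHw]; first by rewrite /mon_of_word !big_nil Omega_tU1.
rewrite big_cons -IHw mon_of_word_cons.
exact: Omega_t_ucmM.
Qed.

Lemma Omega_t_monoid_morphism : monoid_morphism (@Omega_t k A).
Proof.
split=> [|x y]; first by rewrite Omega_t_poly_ext rmorph1.
by rewrite !Omega_t_poly_ext rmorphM.
Qed.

HB.instance Definition _ := GRing.isMonoidMorphism.Build (H_BCK k A) (H_MKW k A)
  (@Omega_t k A) Omega_t_monoid_morphism.

Lemma Phi_com_Ab (t : ptree A) : Phi_com (nclass t) = Ab (Phi_fer t).
Proof. exact: Phi_com_nclass. Qed.

(** Both images are the sum, with coefficient [sigma_w (ucm M)], of the ordered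
    trees whose abelianized word is [M]: the symmetry factors by which
    [j_monomial] divides are restored by [Omega_t].  Characteristic zero makes
    these factors invertible. *)
Lemma square_generator (char_k : [pchar k] =i pred0) (M : Nmon A) :
  Jmap (Omega_w_monomial M) = Omega_t (j_monomial M) :> H_MKW k A.
Proof.
apply/malgP => g; rewrite mcoeff_Jmap mcoeff_Omega_t mcoeffZ.
rewrite (mcoeff_fsbig _ _ (finite_Ab _)) (mcoeff_fsbig _ _ (finite_Phi_com _)).
under eq_bigr => w _ do rewrite mcoeffU.
under [in RHS]eq_bigr => tau _ do rewrite mcoeffZ mcoeffU eq_sym forget_planar_eq_ucm.
(* Only words of length one occur in either image.                             *)
case: g => [|t [|u g]].
- by rewrite !big1 ?mulr0 // => tau _; rewrite mulr0.
- rewrite /= (eq_bigr (fun w => 1 *+ (w == Phi_fer t))); last first.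
    by move=> w _; rewrite eqseq_cons andbT.
  rewrite [in RHS](eq_bigr (fun tau =>
    ((sigma_w (ucm M))%:R / (sigma_t (ucm tau))%:R : k) *+ (tau == nclass t)));
    last first.
    by move=> tau _; rewrite eqseq_cons andbT eq_sym mulrnAr mulr1.
  rewrite !sum_delta !mem_fset_preimage; [|exact: finite_Phi_com|exact: finite_Ab].
  rewrite Phi_com_Ab /forget_planar /= mon_of_word1 !mulrnAr mulr1; congr (_ *+ _).
  have sigma_neq0 : (sigma_t (ucm (nclass t)))%:R != 0 :> k.
    by have /pcharf0P -> := char_k; rewrite -lt0n card_forest_aut_gt0.
  by rewrite mulrCA divff ?mulr1.
- by rewrite !big1 ?mulr0 // => x _; rewrite eqseq_cons andbF ?mulr0.
Qed.

End MainMaps.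

Theorem theorem5p5 (k : fieldType) (char_k : [pchar k] =i pred0) (A : finType) :
  (Jmap \o Omega_w : H_LOT k A -> H_MKW k A) =1 Omega_t \o jmap.
Proof.
apply: poly_morph_eq => M /=.
by rewrite /Omega_w /jmap !poly_extU; apply: square_generator.
Qed.
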